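(* Let $\epsilon,\delta>0$, $z_0\in\mathcal Z$ and $\ell\in H^1(0,T;\mathcal V^* )$ with $-D_z\mathcal I(\ell(0),z_0)\in\partial\mathcal R(0)$. The solution $z_{\epsilon,\delta}\in H^2(0,T;\mathcal Z)$ of (RIS$_{\epsilon,\delta}$) satisfies $$\epsilon\langle z_{\epsilon,\delta}''(t),z_{\epsilon,\delta}'(t)\rangle_{\mathcal V^*,\mathcal V}+\delta\langle Az_{\epsilon,\delta}''(t),z_{\epsilon,\delta}'(t)\rangle_{\mathcal Z^*,\mathcal Z}+\Big\langle\frac{d}{dt}D_z\mathcal I(\ell(t),z_{\epsilon,\delta}(t)),z_{\epsilon,\delta}'(t)\Big\rangle_{\mathcal Z^*,\mathcal Z}=0$$ for almost all $t\in(0,T)$. Furthermore, for all $t\in[0,T]$, $$\frac\epsilon2\|z_{\epsilon,\delta}'(t)\|_{\mathcal V}^2+\frac\delta2|z_{\epsilon,\delta}'(t)|_{\mathcal Z}^2+\int_0^tD_z^2\mathcal E(z_{\epsilon,\delta}(r))[z_{\epsilon,\delta}'(r),z_{\epsilon,\delta}'(r)]\,dr=\int_0^t\langle\ell'(r),z_{\epsilon,\delta}'(r)\rangle_{\mathcal V^*,\mathcal V}\,dr.$$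
   Context: Standing assumptions. $T>0$; $\mathcal Z,\mathcal V$ are real Hilbert spaces and $\mathcal X,\mathcal W$ Banach spaces such that $\mathcal Z\hookrightarrow\mathcal V$ densely and compactly, $\mathcal V\hookrightarrow\mathcal X$ continuously, $\mathcal Z\hookrightarrow\mathcal W$ compactly and $\mathcal W\hookrightarrow\mathcal V$ continuously. Elements of $\mathcal V$ are identified with elements of $\mathcal V^*\hookrightarrow\mathcal Z^*$ via the Riesz isomorphism of $\mathcal V$. The energy is $\mathcal I(\ell,z)=\frac12\langle Az,z\rangle_{\mathcal Z^*,\mathcal Z}+\mathcal F(z)-\langle\ell,z\rangle_{\mathcal V^*,\mathcal V}$ for $\ell\in\mathcal V^*$, $z\in\mathcal Z$, so $D_z\mathcal I(\ell,z)=Az+D_z\mathcal F(z)-\ell\in\mathcal Z^*$. The reduced energy is $\mathcal E(z)=\frac12\langle Az,z\rangle_{\mathcal Z^*,\mathcal Z}+\mathcal F(z)$. $A\in L(\mathcal Z,\mathcal Z^* )$ is symmetric and coercive: $\langle Az,w\rangle=\langle Aw,z\rangle$, $\langle Az,z\rangle\ge\alpha\|z\|_{\mathcal Z}^2$ for some $\alpha>0$; $|z|_{\mathcal Z}:=\langle Az,z\rangle^{1/2}$. $\mathcal F:\mathcal Z\to\mathbb R$ satisfies: $\mathcal F\in C^2(\mathcal Z;\mathbb R)$, $\mathcal F\ge0$; $D_z\mathcal F\in C^1(\mathcal Z;\mathcal V^* )$ with $\|D_z^2\mathcal F(z)v\|_{\mathcal V^*}\le\gamma(1+\|z\|_{\mathcal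 Z}^q)\|v\|_{\mathcal Z}$ for all $v,z\in\mathcal Z$, with some $q\in[0,1/2)$, $\gamma>0$; $z_k\rightharpoonup z$ in $\mathcal Z$ implies $D_z\mathcal F(z_k)\rightharpoonup D_z\mathcal F(z)$ in $\mathcal Z^*$; $D_z^2\mathcal F$ extends to $\mathcal W$ with values in $L(\mathcal Z,\mathcal V^* )$ and the extension is continuous from $\mathcal W$ to $L(\mathcal Z,\mathcal V^* )$; $D_z^2\mathcal F:\mathcal Z\to L(\mathcal Z,\mathcal Z^* )$ is Lipschitz continuous on bounded sets. The dissipation $\mathcal R:\mathcal Z\to[0,\infty)$ is proper, convex, lower semicontinuous, positively 1-homogeneous, and $\underline c\|z\|_{\mathcal X}\le\mathcal R(z)\le\overline c\|z\|_{\mathcal V}$ for all $z\in\mathcal Z$ with constants $\underline c,\overline c>0$. $\partial$ denotes the convex subdifferential (a subset of $\mathcal Z^*$). (RIS$_{\epsilon,\delta}$): $0\in\partial\mathcal R_{\epsilon,\delta}(z'(t))+D_z\mathcal I(\ell(t),z(t))$ for a.a. $t\in(0,T)$, $z(0)=z_0$, with $\mathcal R_{\epsilon,\delta}(z)=\mathcal R(z)+\frac\epsilon2\|z\|_{\mathcal V}^2+\frac\delta2|z|_{\mathcal Z}^2$; it has a unique solution, which lies in $H^2(0,T;\mathcal Z)$. *)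

(* Defs.v *)
From HB Require Import structures.
From mathcomp Require Import all_boot all_order all_algebra.
From mathcomp Require Import all_classical all_reals all_analysis.
Set Implicit Arguments.
Unset Strict Implicit.
Unset Printing Implicit Defensive.
Import Order.TTheory GRing.Theory Num.Theory.
Import numFieldNormedType.Exports.
Local Open Scope classical_set_scope.
Local Open Scope ring_scope.

HB.mixin Record CompleteNormedModule_isHilbert (R : realType) V
    & CompleteNormedModule R V := {
  dotp : V -> V -> R ;
  dotpC : forall x y, dotp x y = dotp y x ;
  dotp_linear : forall a x y z,
    dotp (a *: x + y) z = a * dotp x z + dotp y z ;
  dotp_norm : forall x, dotp x x = `|x| ^+ 2
}.

#[short(type="hilbertType")]
HB.structure Definition Hilbert (R : realType) :=
  {V of CompleteNormedModule R V & CompleteNormedModule_isHilbert R V}.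

(* [clin E F] is the space L(E, F) of continuous linear maps, with the        *)
(* operator norm.                                                             *)
Section clin_def.
Context {R : realType} (E F : normedModType R).

Definition is_clin : {pred E -> F} :=
  fun f => `[< linear f /\ continuous f >].

Record clin := CLin { clin_fun :> E -> F ; clinP : clin_fun \in is_clin }.

HB.instance Definition _ := [isSub for clin_fun].
HB.instance Definition _ := [Choice of clin by <:].

Lemma clin_submod : submod_closed is_clin.
Proof.
split=> [|a f g /asboolP[lf cf] /asboolP[lg cg]]; apply/asboolP; split.
- by move=> a x y /=; rewrite scaler0 addr0.
- exact: cst_continuous.
- move=> b x y; rewrite !fctE lf lg !scalerDr !scalerA [b * a]mulrC.
  by rewrite addrACA.
- move=> x; apply: (@continuousD _ _ _ (a \*: f) g); last exact: cg.
  by apply: continuousZl_tmp; exact: cf.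
Qed.

HB.instance Definition _ :=
  GRing.isSubmodClosed.Build R (E -> F) is_clin clin_submod.
HB.instance Definition _ := [SubChoice_isSubLmodule of clin by <:].

Lemma clin_linear (f : clin) : linear f.
Proof. by case: f => f /= /asboolP[]. Qed.

Lemma clin_continuous (f : clin) : continuous f.
Proof. by case: f => f /= /asboolP[]. Qed.

HB.instance Definition _ (f : clin) :=
  GRing.isLinear.Build R E F *:%R (clin_fun f) (clin_linear f).

Definition opnorm (f : clin) : R :=
  sup [set `|f x| | x in [set x : E | `|x| <= 1]].

Lemma opnorm_has_sup (f : clin) :
  has_sup [set `|f x| | x in [set x : E | `|x| <= 1]].
Proof.
split; first by exists `|f 0|, 0 => //=; rewrite normr0.
have /linear_bounded_continuous/bounded_funP/(_ 1)[M fM] :=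
  @clin_continuous f.
by exists M => _ [x x1 <-]; exact: fM.
Qed.

Lemma opnorm_ub (f : clin) x : `|f x| <= opnorm f * `|x|.
Proof.
have [->|x0] := eqVneq x 0; first by rewrite linear0 !normr0 mulr0.
have nx0 : 0 < `|x| by rewrite normr_gt0.
rewrite -ler_pdivrMr// mulrC -[`|x|^-1]gtr0_norm ?invr_gt0// -normrZ -linearZ.
apply: ub_le_sup; first by case: (opnorm_has_sup f).
exists (`|x|^-1 *: x) => //=.
by rewrite normrZ gtr0_norm ?invr_gt0// mulVf ?gt_eqF.
Qed.

Lemma opnorm_le (f : clin) c :
  (forall x, `|x| <= 1 -> `|f x| <= c) -> opnorm f <= c.
Proof.
move=> fc; apply: ge_sup; first by case: (opnorm_has_sup f).
by move=> _ [x x1 <-]; exact: fc.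
Qed.

Lemma opnorm_ge0 (f : clin) : 0 <= opnorm f.
Proof.
rewrite -(normr0 F) -(linear0 f).
apply: ub_le_sup; first by case: (opnorm_has_sup f).
by exists 0; rewrite /= ?normr0.
Qed.

Lemma opnormD (f g : clin) : opnorm (f + g) <= opnorm f + opnorm g.
Proof.
apply: opnorm_le => x x1.
apply: (le_trans (ler_normD (f x) (g x))); apply: lerD.
- by apply: (le_trans (opnorm_ub f x)); rewrite ler_piMr ?opnorm_ge0.
- by apply: (le_trans (opnorm_ub g x)); rewrite ler_piMr ?opnorm_ge0.
Qed.

Lemma opnormZ_le (a : R) (f : clin) : opnorm (a *: f) <= `|a| * opnorm f.
Proof.
apply: opnorm_le => x x1.
rewrite -[(a *: f) x]/(a *: f x) normrZ ler_wpM2l//.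
by apply: (le_trans (opnorm_ub f x)); rewrite ler_piMr ?opnorm_ge0.
Qed.

Lemma opnormZ (a : R) (f : clin) : opnorm (a *: f) = `|a| * opnorm f.
Proof.
apply/eqP; rewrite eq_le opnormZ_le/=.
have [->|a0] := eqVneq a 0; first by rewrite normr0 mul0r opnorm_ge0.
have := opnormZ_le a^-1 (a *: f).
rewrite scalerA mulVf// scale1r normfV => h.
by rewrite -ler_pdivlMl ?normr_gt0.
Qed.

Lemma opnorm_eq0 (f : clin) : opnorm f = 0 -> f = 0.
Proof.
move=> f0; apply/val_inj/funext => x /=.
by apply/eqP; rewrite -normr_le0 -(mul0r `|x|) -f0; exact: opnorm_ub.
Qed.

HB.instance Definition _ :=
  Lmodule_isNormed.Build R clin opnormD opnormZ opnorm_eq0.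

(* [f] itself when it is linear and continuous, and 0 otherwise.              *)
Definition to_clin (f : E -> F) : clin := insubd (0 : clin) f.

Lemma to_clinE (f : E -> F) : linear f -> continuous f -> to_clin f = f :> (E -> F).
Proof. by move=> lf cf; rewrite /to_clin insubdK//; apply/asboolP. Qed.

End clin_def.

Notation dual_space E := (clin E (GRing.regular _)).

Section embeddings.
Context {R : realType} {E F : normedModType R}.

Definition embedding (i : clin E F) := injective i.

Definition compact_embedding (i : clin E F) :=
  injective i /\ precompact (i @` [set x | `|x| <= 1]).

Definition dense_embedding (i : clin E F) := injective i /\ dense (range i).

End embeddings.

Section riesz.
Context {R : realType} {V : hilbertType R}.

Definition riesz (v : V) : dual_space V := to_clin (dotp v : V -> R^o).

Lemma dotp_le (v w : V) : `|dotp v w| <= `|v| * `|w|.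
Proof.
have dotpD (a : R) (x y z : V) : dotp z (a *: x + y) = a * dotp z x + dotp z y.
  by rewrite dotpC dotp_linear !(dotpC _ z).
have dotp0 (z : V) : dotp z 0 = 0.
  by have := dotpD (-1) 0 0 z; rewrite scaler0 addr0 mulN1r addNr.
have [->|w0] := eqVneq w 0; first by rewrite dotp0 !normr0 mulr0.
rewrite -(@ler_pXn2r _ 2)// ?nnegrE ?mulr_ge0// exprMn real_normK ?num_real//.
have ww : 0 < `|w| ^+ 2 by rewrite exprn_gt0 ?normr_gt0.
set u := - (dotp v w / `|w| ^+ 2) *: w + v.
have : 0 <= dotp u u by rewrite dotp_norm sqr_ge0.
rewrite {1}/u dotp_linear dotpD -[dotp v u]dotpC {1}/u dotp_linear.
rewrite !dotp_norm (dotpC w v).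
set d := dotp v w; set a := `|w| ^+ 2 in ww *.
rewrite [- (d / a) * a]mulNr divfK ?gt_eqF// addNr mulr0 add0r.
by rewrite mulNr addrC subr_ge0 mulrAC -expr2 ler_pdivrMr.
Qed.

Lemma rieszE (v w : V) : riesz v w = dotp v w.
Proof.
rewrite /riesz.
have lv : linear (dotp v : V -> R^o).
  by move=> a x y; rewrite dotpC dotp_linear !(dotpC _ v).
rewrite to_clinE//.
pose f : {linear V -> R^o} :=
  HB.pack (dotp v : V -> R^o) (GRing.isLinear.Build _ _ _ _ _ lv).
have /bounded_linear_continuous : bounded_near f (nbhs (0 : V)).
  apply/linear_boundedP; apply: filterS (nbhs_pinfty_ge (num_real `|v|)) => r vr x.
  by apply: (le_trans (dotp_le v x)); rewrite ler_wpM2r.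
by [].
Qed.

End riesz.

Section frechet.
Context {R : realType} {E F : normedModType R}.

Definition frechet (f : E -> F) (x : E) : clin E F := to_clin ('d f x).

Definition class_C1 (f : E -> F) :=
  (forall x, differentiable f x) /\ continuous (frechet f).

End frechet.

Definition class_C2 {R : realType} {E F : normedModType R} (f : E -> F) :=
  class_C1 f /\ class_C1 (frechet f).

Definition weak_cvg {R : realType} {E : normedModType R}
    (u : nat -> E) (l : E) :=
  forall phi : dual_space E, phi (u n) @[n --> \oo] --> phi l.

(* Convex subdifferential at [v] of a finite convex function.                 *)
Definition subdiff {R : realType} {E : normedModType R} (f : E -> R) (v : E)
    : set (dual_space E) :=
  [set xi | forall w, f v + xi (w - v) <= f w].

Section vector_valued.
Context {R : realType} {E : normedModType R}.
Local Notation mu := (@lebesgue_measure R).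

Definition simple_fun (s : R -> E) :=
  finite_set (range s) /\ forall x, measurable (s @^-1` [set x]).

Definition simple_integral (a b : R) (s : R -> E) : E :=
  \sum_(x \in range s) fine (mu (`]a, b[%classic `&` s @^-1` [set x])) *: x.

Definition strongly_measurable (A : set R) (g : R -> E) :=
  exists2 s : nat -> R -> E, (forall n, simple_fun (s n)) &
    forall t, A t -> s n t @[n --> \oo] --> g t.

(* [x] is the Bochner integral of [g] over ]a, b[.                            *)
Definition is_bochner_integral (a b : R) (g : R -> E) (x : E) :=
  strongly_measurable `]a, b[ g /\
  exists s : nat -> R -> E, [/\ forall n, simple_fun (s n),
    (\int[mu]_(t in `]a, b[) (`|g t - s n t|)%:E)%E @[n --> \oo] --> 0%E &
    simple_integral a b (s n) @[n --> \oo] --> x].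

(* [g] is a (Borel) representative of an element of L^2(0, T; E).             *)
Definition in_L2 (T : R) (g : R -> E) :=
  strongly_measurable `]0, T[ g /\
  (\int[mu]_(t in `]0%R, T[) (`|g t| ^+ 2)%:E < +oo)%E.

(* [u] is the continuous representative on [0, T] of an element of            *)
(* H^1(0, T; E) whose weak derivative is [du]: the L^2 functions with a weak  *)
(* derivative [du] in L^2 are, up to a null set, the indefinite Bochner       *)
(* integrals of [du].                                                         *)
Definition in_H1 (T : R) (u du : R -> E) :=
  in_L2 T du /\
  forall t, 0 <= t <= T -> is_bochner_integral 0 t du (u t - u 0).

Definition in_H2 (T : R) (u du ddu : R -> E) :=
  in_H1 T u du /\ in_H1 T du ddu.

End vector_valued.

(* The inclusions between the spaces are represented by injective continuous  *)
(* linear maps; the last clause says that Z -> W -> V is the inclusion of Z   *)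
(* in V.                                                                      *)
Record space_assumptions {R : realType} {Z V : hilbertType R}
    {X W : completeNormedModType R} (iZV : clin Z V) (iVX : clin V X)
    (iZW : clin Z W) (iWV : clin W V) : Prop := {
  dense_ZV : dense_embedding iZV ;
  compact_ZV : compact_embedding iZV ;
  embedding_VX : embedding iVX ;
  compact_ZW : compact_embedding iZW ;
  embedding_WV : embedding iWV ;
  coherent_ZWV : forall z, iWV (iZW z) = iZV z
}.

Record elliptic_operator {R : realType} {Z : hilbertType R}
    (A : clin Z (dual_space Z)) : Prop := {
  elliptic_sym : forall z w, A z w = A w z ;
  elliptic_coercive :
    exists2 alpha : R, 0 < alpha & forall z, alpha * `|z| ^+ 2 <= A z z
}.

(* [G] is the derivative of [F] seen as a map into V^* (V^* being embedded in *)
(* Z^* by restriction of functionals), and [H] is the extension of its        *)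
(* derivative to W.                                                           *)
Record potential_assumptions {R : realType} {Z V : hilbertType R}
    {W : completeNormedModType R} (iZV : clin Z V) (iZW : clin Z W)
    (F : Z -> R^o) : Prop := {
  potential_C2 : class_C2 F ;
  potential_ge0 : forall z, 0 <= F z :> R ;
  potential_V : exists G : Z -> dual_space V,
    [/\ forall z w, frechet F z w = G z (iZV w),
        class_C1 G,
        exists q gamma : R, [/\ 0 <= q < 2^-1, 0 < gamma &
          forall v z, `|frechet G z v| <= gamma * (1 + `|z| `^ q) * `|v|] &
        exists2 H : W -> clin Z (dual_space V),
          continuous H & forall z, H (iZW z) = frechet G z] ;
  potential_weak : forall (zs : nat -> Z) z, weak_cvg zs z ->
    weak_cvg (fun n => frechet F (zs n)) (frechet F z) ;
  potential_lip : forall r : R, exists k : R,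
    k.-lipschitz_[set z | `|z| <= r] (frechet (frechet F))
}.

(* Being finite and nonnegative, [D] is proper.                               *)
Record dissipation_assumptions {R : realType} {Z V : hilbertType R}
    {X : completeNormedModType R} (iZV : clin Z V) (iVX : clin V X)
    (D : Z -> R) : Prop := {
  dissipation_ge0 : forall z, 0 <= D z ;
  dissipation_convex : convex_function (E := Z) setT D ;
  dissipation_lsc : lower_semicontinuous (fun z => (D z)%:E) ;
  dissipation_hom : forall a z, 0 < a -> D (a *: z) = a * D z ;
  dissipation_bounds : exists c C : R, [/\ 0 < c, 0 < C &
    forall z, c * `|iVX (iZV z)| <= D z <= C * `|iZV z|]
}.

Section rate_independent_system.
Context {R : realType} {Z V : hilbertType R} (iZV : clin Z V).
Variables (A : clin Z (dual_space Z)) (F : Z -> R^o) (D : Z -> R).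

Definition normA (z : Z) : R := Num.sqrt (A z z).

Definition reduced_energy (z : Z) : R^o := 2^-1 * A z z + F z.

Definition energy (l : dual_space V) (z : Z) : R^o :=
  2^-1 * A z z + F z - l (iZV z).

Definition D_energy (l : dual_space V) (z : Z) : dual_space Z :=
  frechet (energy l) z.

Definition D2_reduced_energy (z : Z) : clin Z (dual_space Z) :=
  frechet (frechet reduced_energy) z.

Definition viscous_dissipation (eps delta : R) (v : Z) : R :=
  D v + eps / 2 * `|iZV v| ^+ 2 + delta / 2 * normA v ^+ 2.

(* [dz] stands for the derivative of [z]; the two are related separately, by  *)
(* [in_H2].                                                                   *)
Definition solves_RIS (eps delta T : R) (l : R -> dual_space V) (z0 : Z)
    (z dz : R -> Z) :=
  z 0 = z0 /\
  {ae lebesgue_measure, forall t : R, t \in `]0, T[ ->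
    [set xi + D_energy (l t) (z t) |
      xi in subdiff (viscous_dissipation eps delta) (dz t)] 0}.

End rate_independent_system.

(* Main.v *)
Require Import Defs.
From HB Require Import structures.
From mathcomp Require Import all_boot all_order all_algebra finmap.
From mathcomp Require Import all_classical all_reals all_analysis.
From mathcomp Require Import ring lra.
Import Order.TTheory GRing.Theory Num.Theory.
Import numFieldNormedType.Exports.
Local Open Scope classical_set_scope.
Local Open Scope ring_scope.
Set Implicit Arguments.
Unset Strict Implicit.
Unset Printing Implicit Defensive.

(** Write M = eps * Id + delta * A for the operator of the quadratic part of
the dissipation ([viscosity]) and G(t) for the curve of energy gradients
D_z I(l(t), z(t)) ([force]).  At a single time the inclusion says that
eta(t) = - G(t) - M z'(t) ([friction]) belongs to the subdifferential of the
1-homogeneous function D at z'(t), which by homogeneity means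
  <eta(t), w> <= D(w) for every w, and D(z'(t)) <= <eta(t), z'(t)>
([subdiff_viscous]).  Both conditions are closed, and eta and z' are continuous
in time, so they hold at every time of the closed interval and not only almost
everywhere ([friction_subdiff]).

The first identity is a maximality argument.  Fix t.  For every s one has
<eta(s), z'(t)> <= D(z'(t)) <= <eta(t), z'(t)>, so the real function
s |-> <eta(s), z'(t)> is maximal at s = t.  At almost every t the three curves
z, z' and l are differentiable, hence so is this function, its derivative
vanishes, and this is the identity ([derive_balance]).

For the second identity, the derivative of the quadratic form of M along z' is
twice <M z'', z'>; integrating the first identity gives the claim up to the
value at t = 0, which vanishes: the compatibility of the initial data and the
inclusion at t = 0 force <M z'(0), z'(0)> <= 0, so z'(0) = 0 ([dz0]).

What has to be supplied is calculus for curves that are indefinite Bochner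
integrals.  Continuous functionals commute with the Bochner integral
([bochner_dual]), and both the Hilbert space and the dual space at hand are
normed by explicit functionals ([norming_dual]), so all estimates reduce to
Lebesgue integrals of real functions.  Two results carry the proof: such curves
are differentiable almost everywhere ([H1_ae_is_derive]), and a symmetric
continuous bilinear form along them satisfies the fundamental theorem of
calculus ([H1_quadratic]). *)

(** * Continuous linear maps *)

Section clin_tools.
Context {R : realType}.
Implicit Types E G H : normedModType R.

(** [to_clin] returns 0 on maps that are not linear and continuous; a bound is
the easiest way to exclude this. *)
Lemma to_clin_boundedE E G (f : E -> G) (c : R) :
  linear f -> (forall x, `|f x| <= c * `|x|) -> to_clin f = f :> (E -> G).
Proof.
move=> lf fc; apply: to_clinE => //.
pose f' : {linear E -> G} := HB.pack f (GRing.isLinear.Build _ _ _ _ _ lf).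
suff : bounded_near f' (nbhs (0 : E)) by move/bounded_linear_continuous.
apply/linear_boundedP; apply: filterS (nbhs_pinfty_ge (num_real c)) => r cr x.
by apply: (le_trans (fc x)); rewrite ler_wpM2r.
Qed.

Lemma clinD E G (f : clin E G) x y : f (x + y) = f x + f y.
Proof. exact: (linearD f). Qed.

Lemma clinB E G (f : clin E G) x y : f (x - y) = f x - f y.
Proof. exact: (linearB f). Qed.

Lemma clinZ E G (f : clin E G) a x : f (a *: x) = a *: f x.
Proof. exact: (linearZ_LR f). Qed.

Lemma add_clinE E G (f g : clin E G) x : (f + g) x = f x + g x.
Proof. by []. Qed.

Lemma opp_clinE E G (f : clin E G) x : (- f) x = - f x.
Proof. by []. Qed.

Lemma scale_clinE E G (f : clin E G) a x : (a *: f) x = a *: f x.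
Proof. by []. Qed.

Lemma frechetE E G (f : E -> G) x h :
  differentiable f x -> frechet f x h = 'd f x h.
Proof.
move=> df; rewrite /frechet to_clinE //; last exact: diff_continuous.
exact: linearP.
Qed.

Definition clin_comp E G H (g : clin G H) (f : clin E G) : clin E H :=
  to_clin (g \o f).

Lemma clin_compE E G H (g : clin G H) (f : clin E G) x :
  clin_comp g f x = g (f x).
Proof.
rewrite /clin_comp to_clinE //; first by move=> a u v; rewrite /= !linearP.
by move=> y; apply: continuous_comp; exact: clin_continuous.
Qed.

(** Restriction of functionals; along the embedding of Z in V it is the
inclusion of V^* in Z^* that identifies loads with forces on Z. *)
Definition clin_adjoint E G (i : clin E G) : clin (dual_space G) (dual_space E) :=
  to_clin (fun l : dual_space G => clin_comp l i).

Lemma clin_adjointE E G (i : clin E G) l x : clin_adjoint i l x = l (i x).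
Proof.
rewrite /clin_adjoint (@to_clin_boundedE _ _ _ (opnorm i)) ?clin_compE//.
- move=> a u v; apply/val_inj/funext => y.
  rewrite /= [LHS]clin_compE.
  by rewrite -[RHS]/(a * clin_comp u i y + clin_comp v i y) !clin_compE.
- move=> u; apply: opnorm_le => y y1; rewrite clin_compE.
  apply: (le_trans (opnorm_ub u (i y))); rewrite mulrC.
  apply: ler_wpM2r; first exact: opnorm_ge0.
  by apply: (le_trans (opnorm_ub i y)); rewrite ler_piMr ?opnorm_ge0.
Qed.

Lemma clin_diff E G (f : clin E G) x : is_diff x (f : E -> G) (f : E -> G).
Proof.
apply: DiffDef; first exact/linear_differentiable/clin_continuous.
by rewrite diff_lin//; exact: clin_continuous.
Qed.

Lemma dual_scaleE E (phi : dual_space E) c y : phi (c *: y) = c * phi y.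
Proof. exact: clinZ. Qed.

Lemma dual_linE E (phi : dual_space E) x c y :
  phi (x + c *: y) = phi x + c * phi y.
Proof. by rewrite clinD dual_scaleE. Qed.

Lemma bilinear_linE E G (B : clin E (dual_space G)) x c y w :
  B (x + c *: y) w = B x w + c * B y w.
Proof. by rewrite clinD clinZ. Qed.

Lemma bilinear_norm_le E G H (B : clin E (clin G H)) x y :
  `|B x y| <= `|B| * `|x| * `|y|.
Proof.
apply: (le_trans (opnorm_ub (B x) y)).
by rewrite ler_wpM2r// (opnorm_ub B x).
Qed.

(** The canonical embedding in the bidual. It makes the pairing of a curve of
functionals with a fixed vector a continuous linear image of the curve. *)
Definition eval_at E (x : E) : dual_space (dual_space E) :=
  to_clin (fun l : dual_space E => l x : R^o).

Lemma eval_atE E (x : E) l : eval_at x l = l x.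
Proof.
rewrite /eval_at (@to_clin_boundedE _ _ _ `|x|)// => m.
by rewrite mulrC; exact: (opnorm_ub m x).
Qed.

End clin_tools.

Section curves.
Context {R : realType} {E G : normedModType R}.

Lemma is_derive_curve_comp (g : E -> G) (u : R -> E) (du : E) (t : R) :
  differentiable g (u t) -> is_derive t 1 u du ->
  is_derive t 1 (g \o u) (frechet g (u t) du).
Proof.
move=> dg [du1 <-].
have dfu : differentiable u t by apply/derivable1_diffP.
have dgu : differentiable (g \o u) t by exact: differentiable_comp.
apply: DeriveDef; first exact/derivable1_diffP.
by rewrite deriveE// diff_comp//= frechetE// deriveE.
Qed.

Lemma is_derive_curve_clin (g : clin E G) (u : R -> E) (du : E) (t : R) :
  is_derive t 1 u du -> is_derive t 1 (g \o u) (g du).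
Proof.
move=> h; have [dg eg] := clin_diff g (u t).
have := is_derive_curve_comp dg h; rewrite frechetE//.
by rewrite eg.
Qed.

End curves.

(** * Derivatives of the energies *)

Section energy_derivatives.
Context {R : realType} {Z V : hilbertType R} (iZV : clin Z V).
Variables (A : clin Z (dual_space Z)) (F : Z -> R^o).
Hypothesis ellA : elliptic_operator A.
Hypothesis F2 : class_C2 F.

(** By symmetry the increment of z |-> A z z / 2 at z is A z h + A h h / 2,
and the remainder is at most |A| |h|^2 / 2. *)
Lemma half_quadratic_diff (z : Z) :
  is_diff z (fun z => 2^-1 * A z z : R^o) (A z : Z -> R^o).
Proof.
have symA := elliptic_sym ellA.
have nearA (h : Z) : (fun z => 2^-1 * A z z : R^o) (h + z) =
    2^-1 * A z z + A z h + 2^-1 * A h h.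
  rewrite /= (clinD A) add_clinE !linearD /= (symA h z).
  rewrite -[2^-1 * A z z + A z h + _]/((2^-1 * A z z + A z h + 2^-1 * A h h) : R).
  by field.
have E0 : (fun z => 2^-1 * A z z : R^o) \o shift z =
    cst (2^-1 * A z z : R^o) + (A z : Z -> R^o) +o_ (0:Z) id.
  apply/eqaddoP => e e0 /=.
  have eA : 0 < e / (`|A| + 1) by rewrite divr_gt0// ltr_wpDl.
  have hA0 : \forall h \near (0 : Z), `|h| <= e / (`|A| + 1).
    exact: nbhs0_le.
  apply: filterS hA0 => h hA.
  rewrite !fctE /= nearA addrAC subrr add0r.
  rewrite normrM gtr0_norm//.
  apply: (@le_trans _ _ (2^-1 * (`|A| * `|h| * `|h|))).
    by rewrite ler_wpM2l// bilinear_norm_le.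
  have : `|A| * `|h| <= e.
    by move: hA (normr_ge0 h); rewrite ler_pdivlMr ?ltr_wpDl//; lra.
  move=> /(ler_wpM2r (normr_ge0 h)).
  have := mulr_ge0 (ltW e0) (normr_ge0 h).
  lra.
split; last by apply: diff_unique => //; exact: clin_continuous.
apply/diff_locallyP.
suff -> : 'd (fun z => 2^-1 * A z z : R^o) z = A z :> (Z -> R^o).
  by split=> //; exact: clin_continuous.
by apply: diff_unique => //; exact: clin_continuous.
Qed.

Let F1 z : differentiable F z. Proof. by case: F2 => -[]. Qed.

Lemma reduced_energy_diff (z : Z) :
  is_diff z (reduced_energy A F) (A z + frechet F z : Z -> R^o).
Proof.
have hq := half_quadratic_diff z.
have hF : is_diff z F (frechet F z).
  by apply: DiffDef => //; apply/funext => h; rewrite frechetE.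
by have := is_diffD hq hF.
Qed.

Lemma frechet_reduced_energy : frechet (reduced_energy A F) =
  (A : Z -> dual_space Z) + (frechet F : Z -> dual_space Z).
Proof.
apply/funext => z; apply/val_inj/funext => h.
have [d e] := reduced_energy_diff z.
by rewrite [LHS]frechetE// e.
Qed.

Lemma D_energyE l z :
  D_energy iZV A F l z = A z + frechet F z - clin_adjoint iZV l.
Proof.
apply/val_inj/funext => h.
have hE := reduced_energy_diff z.
have hl := clin_diff (clin_adjoint iZV l) z.
have [d e] := is_diffB hE hl.
have eqE : energy iZV A F l =
    reduced_energy A F - (clin_adjoint iZV l : Z -> R^o).
  by apply/funext => y; rewrite !fctE /= clin_adjointE.
by rewrite /D_energy eqE [LHS]frechetE// e.
Qed.

Lemma differentiable_Dreduced (z : Z) :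
  differentiable ((A : Z -> dual_space Z) + (frechet F : Z -> dual_space Z)) z.
Proof.
apply: differentiableD; first by have [] := clin_diff A z.
by case: F2 => _ [].
Qed.

Lemma D2_reduced_energyE z :
  D2_reduced_energy A F z = A + frechet (frechet F) z.
Proof.
rewrite /D2_reduced_energy frechet_reduced_energy.
apply/val_inj/funext => h.
have [dA eA] := clin_diff A z.
have dF : differentiable (frechet F) z by case: F2 => _ [].
rewrite [LHS]frechetE; last exact: differentiable_Dreduced.
rewrite diffD//= -[RHS]/(A h + frechet (frechet F) z h) frechetE//.
congr (_ + _).
by rewrite eA.
Qed.

End energy_derivatives.

(** * Norms as suprema over functionals *)

Section norming.
Context {R : realType}.

(** The functionals of norm at most one determine the norm. For the spaces in
which the curves below take their values this is elementary: a Hilbert space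
is normed by its Riesz functionals, a dual space by evaluations. *)
Definition norming_dual (E : normedModType R) := forall (x : E) (c : R),
  (forall phi : dual_space E, (forall y, `|phi y| <= `|y|) -> phi x <= c) ->
  `|x| <= c.

Definition riesz_clin (V : hilbertType R) : clin V (dual_space V) :=
  to_clin (riesz : V -> dual_space V).

Lemma riesz_clinE (V : hilbertType R) (v : V) : riesz_clin V v = riesz v.
Proof.
rewrite /riesz_clin (@to_clin_boundedE _ _ _ _ 1)//.
- move=> a x y; apply/val_inj/funext => w.
  rewrite -[RHS]/(a * riesz x w + riesz y w) -[LHS]/(riesz (a *: x + y) w).
  by rewrite !rieszE dotp_linear.
- move=> x; rewrite mul1r; apply: opnorm_le => w w1; rewrite rieszE.
  by apply: (le_trans (dotp_le x w)); rewrite ler_piMr.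
Qed.

Lemma norming_dual_hilbert (V : hilbertType R) : norming_dual V.
Proof.
move=> x c xc; have [->|x0] := eqVneq x 0.
  have z0 (y : V) : `|(0 : dual_space V) y| <= `|y|.
    by have -> : `|(0 : dual_space V) y| = 0 by exact: normr0.
  by rewrite normr0; exact: (xc 0 z0).
have nx : 0 < `|x| by rewrite normr_gt0.
pose phi := `|x|^-1 *: riesz x.
have phiE y : phi y = `|x|^-1 * dotp x y by rewrite /phi scale_clinE rieszE.
have phi1 y : `|phi y| <= `|y|.
  by rewrite phiE normrM normfV normr_id ler_pdivrMl// dotp_le.
by have := xc phi phi1; rewrite phiE dotp_norm expr2 mulKf ?gt_eqF.
Qed.

Lemma norming_dual_dual (E : normedModType R) : norming_dual (dual_space E).
Proof.
move=> l c lc; apply: opnorm_le => x x1.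
have h (e : R) : `|e| <= 1 -> e * l x <= c.
  move=> e1; pose phi := e *: eval_at x.
  have phiE m : phi m = e * m x by rewrite /phi scale_clinE eval_atE.
  rewrite -phiE; apply: lc => m; rewrite phiE normrM -[leRHS]mul1r ler_pM//.
  by apply: (le_trans (opnorm_ub m x)); rewrite ler_piMr// opnorm_ge0.
have := h 1; have := h (-1); rewrite normrN normr1 mulN1r mul1r => h1 h2.
by rewrite ler_norml lerNl h1// h2.
Qed.

End norming.

(** * The viscosity operator *)

Section viscosity.
Context {R : realType} {Z V : hilbertType R} (iZV : clin Z V).
Variables (A : clin Z (dual_space Z)).
Variables (eps delta : R).

(** The quadratic part of the viscous dissipation is half the quadratic form
of this operator, which is therefore its derivative. *)
Definition viscosity : clin Z (dual_space Z) :=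
  eps *: clin_comp (clin_adjoint iZV) (clin_comp (riesz_clin V) iZV) + delta *: A.

Lemma viscosityE v w :
  viscosity v w = eps * riesz (iZV v) (iZV w) + delta * A v w.
Proof.
have comb (B C : clin Z (dual_space Z)) :
  (eps *: B + delta *: C) v w = eps * B v w + delta * C v w.
  rewrite (add_clinE (eps *: B) (delta *: C) v).
  rewrite (add_clinE ((eps *: B) v) ((delta *: C) v) w).
  by rewrite (scale_clinE B eps v) (scale_clinE (B v) eps w)
    (scale_clinE C delta v) (scale_clinE (C v) delta w).
by rewrite /viscosity comb clin_compE clin_adjointE clin_compE riesz_clinE.
Qed.

End viscosity.

(** * Reduction of the Bochner integral to Lebesgue integrals *)

Section Rintegral_sum.
Context d {T : measurableType d} {R : realType} (mu : {measure set T -> \bar R}).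

Lemma Rintegral_sum (D : set T) (I : Type) (r : seq I) (f : I -> T -> R) :
  measurable D -> (forall i, mu.-integrable D (EFin \o f i)) ->
  \int[mu]_(x in D) (\sum_(i <- r) f i x) =
  \sum_(i <- r) \int[mu]_(x in D) f i x.
Proof.
move=> mD intf; elim: r => [|i r IHr].
  by under eq_Rintegral do rewrite big_nil; rewrite big_nil Rintegral_cst// mul0r.
under eq_Rintegral do rewrite big_cons.
rewrite big_cons RintegralD// ?IHr//.
have -> : EFin \o (fun x => \sum_(j <- r) f j x) =
    (fun x => \sum_(j <- r) (EFin \o f j) x)%E.
  by apply/funext => x; rewrite /= -sumEFin.
exact: integrable_sum.
Qed.

End Rintegral_sum.

Section simple.
Context {R : realType} {E : normedModType R}.
Local Notation mu := (@lebesgue_measure R).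

Lemma measurable_simple_comp (D : set R) (s : R -> E) (q : R -> E -> R) :
  measurable D -> simple_fun s -> (forall x, measurable_fun D (q ^~ x)) ->
  measurable_fun D (fun r => q r (s r)).
Proof.
move=> mD [fs ms] mq _ Y mY.
have -> : D `&` (fun r => q r (s r)) @^-1` Y =
    \bigcup_(x in range s) (s @^-1` [set x] `&` (D `&` q^~ x @^-1` Y)).
  apply/seteqP; split=> [r [Dr Yr]|r [x _ [/= <- [Dr Yr]]]]//.
  by exists (s r) => //; exists r.
apply: fin_bigcup_measurable => // x _.
by apply: measurableI; [exact: ms|exact: mq].
Qed.

(** The integrands that occur, such as the power dl r (iZV (dz r)), pair a
strongly measurable curve with a functional that itself depends on time. For a
simple curve, preimages split along its finitely many level sets; the general
case is a pointwise limit of such, by continuity of q r. *)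
Lemma measurable_caratheodory (D : set R) (g : R -> E) (q : R -> E -> R) :
  measurable D -> strongly_measurable D g ->
  (forall x, measurable_fun D (q ^~ x)) ->
  (forall r, D r -> continuous (q r)) ->
  measurable_fun D (fun r => q r (g r)).
Proof.
move=> mD [s ss sg] mq cq.
apply: (@measurable_realfun.measurable_fun_cvg _ _ _ _ (fun n r => q r (s n r))).
  by move=> n; exact: measurable_simple_comp.
by move=> r Dr; apply: continuous_cvg; [exact: cq|exact: sg].
Qed.

Lemma simple_fun_sum (h : E -> R) (s : R -> E) r : simple_fun s ->
  h (s r) = \sum_(x <- fset_set (range s)) h x * \1_(s @^-1` [set x]) r.
Proof.
move=> [fs _]; have sr : s r \in fset_set (range s).
  by rewrite in_fset_set//; apply: mem_set; exists r.
rewrite (big_rem _ sr)/= indicE mem_set//= mulr1 big1_seq ?addr0// => x /= xr.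
rewrite indicE memNset ?mulr0//= => sx; move: xr.
by rewrite -sx mem_rem_uniqF ?fset_uniq.
Qed.

Lemma integrable_simple (D : set R) (h : E -> R) (s : R -> E) :
  measurable D -> (mu D < +oo)%E -> simple_fun s ->
  mu.-integrable D (EFin \o (h \o s)).
Proof.
move=> mD Dfin ss.
apply: measurable_bounded_integrable => //.
  by apply: (measurable_simple_comp (q := fun=> h)) => // x; exact: measurable_cst.
case: ss => fs _.
have /finite_seqP[S hS] : finite_set ((fun x => `|h x|) @` range s).
  exact: finite_image.
exists (\sum_(x <- S) `|x|); split; first exact: num_real.
move=> M SM r _ /=; apply: le_trans (ltW SM).
have rS : `|h (s r)| \in S.
  have : [set` S] `|h (s r)| by rewrite -hS; exists (s r) => //; exists r.
  by [].
by rewrite (big_rem _ rS)/= normr_id lerDl sumr_ge0.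
Qed.

Lemma simple_integral_dual (phi : dual_space E) (a b : R) (s : R -> E) :
  simple_fun s ->
  phi (simple_integral a b s) = \int[mu]_(r in `]a, b[) (phi (s r)).
Proof.
move=> ss; have [fs ms] := ss; rewrite /simple_integral fsbig_finite//=.
rewrite linear_sum/=.
have Ifin : (mu (`]a, b[ : set R) < +oo)%E.
  by rewrite lebesgue_measure_itv/=; case: ifPn; rewrite ?ltry.
have mI : measurable (`]a, b[ : set R) by exact: measurable_itv.
under eq_Rintegral do rewrite (simple_fun_sum phi _ ss).
have intX x : mu.-integrable `]a, b[ (EFin \o (\1_(s @^-1` [set x]) : R -> R)).
  have -> : (\1_(s @^-1` [set x]) : R -> R) = (fun y => (y \in [set x])%:R) \o s.
    by apply/funext => r; rewrite indicE.
  exact: integrable_simple.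
rewrite Rintegral_sum//; last first.
  move=> x.
  have -> : EFin \o (fun r => phi x * \1_(s @^-1` [set x]) r) =
      (fun r => (phi x)%:E * (EFin \o (\1_(s @^-1` [set x]) : R -> R)) r)%E.
    by apply/funext => r.
  exact: integrableZl.
apply: eq_bigr => x _; rewrite RintegralZl// /Rintegral integral_indic//; last exact: ms.
by rewrite linearZ/= mulrC setIC.
Qed.

End simple.

Section real_integrals.
Context {R : realType}.
Local Notation mu := (@lebesgue_measure R).

Lemma integrable_le (D : set R) (f g : R -> R) :
  measurable D -> measurable_fun D f -> (forall x, D x -> `|f x| <= g x) ->
  mu.-integrable D (EFin \o g) -> mu.-integrable D (EFin \o f).
Proof.
move=> mD mf fg; apply: (@le_integrable _ _ R mu D mD (EFin \o f)) => //.
  by apply/measurable_realfun.measurable_EFinP.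
move=> x Dx; rewrite /= lee_fin; apply: (le_trans (fg x Dx)).
exact: ler_norm.
Qed.

Lemma integrable_scale (D : set R) (c : R) (f : R -> R) :
  measurable D -> mu.-integrable D (EFin \o f) ->
  mu.-integrable D (EFin \o (fun r => c * f r)).
Proof.
move=> mD intf.
have -> : EFin \o (fun r => c * f r) = (fun r => c%:E * (EFin \o f) r)%E.
  by apply/funext.
exact: integrableZl.
Qed.

Lemma integrable_add (D : set R) (f g : R -> R) :
  measurable D -> mu.-integrable D (EFin \o f) -> mu.-integrable D (EFin \o g) ->
  mu.-integrable D (EFin \o (fun r => f r + g r)).
Proof.
move=> mD intf intg.
have -> : EFin \o (fun r => f r + g r) = ((EFin \o f) \+ (EFin \o g))%E.
  by apply/funext.
exact: integrableD.
Qed.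

Lemma integrable_sub (D : set R) (f g : R -> R) :
  measurable D -> mu.-integrable D (EFin \o f) -> mu.-integrable D (EFin \o g) ->
  mu.-integrable D (EFin \o (fun r => f r - g r)).
Proof.
move=> mD intf intg.
have -> : EFin \o (fun r => f r - g r) = ((EFin \o f) \- (EFin \o g))%E.
  by apply/funext.
exact: integrableB.
Qed.

Lemma normr_Rintegral_le (D : set R) (f h : R -> R) :
  measurable D -> mu.-integrable D (EFin \o f) -> mu.-integrable D (EFin \o h) ->
  (forall x, D x -> `|f x| <= h x) ->
  `|\int[mu]_(x in D) f x| <= \int[mu]_(x in D) h x.
Proof.
move=> mD intf inth fh.
apply: (@le_trans _ _ (\int[mu]_(x in D) `|f x|)).
  exact: le_normr_Rintegral.
apply: le_Rintegral => //.
exact: integrable_norm.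
Qed.

Lemma normr_RintegralB_le (D : set R) (f g h : R -> R) :
  measurable D -> mu.-integrable D (EFin \o f) -> mu.-integrable D (EFin \o g) ->
  mu.-integrable D (EFin \o h) -> (forall x, D x -> `|f x - g x| <= h x) ->
  `|\int[mu]_(x in D) f x - \int[mu]_(x in D) g x| <= \int[mu]_(x in D) h x.
Proof.
move=> mD intf intg inth fgh; rewrite -RintegralB//.
by apply: normr_Rintegral_le => //; exact: integrable_sub.
Qed.

End real_integrals.

Section bochner.
Context {R : realType} {E : normedModType R}.
Local Notation mu := (@lebesgue_measure R).

Lemma strongly_measurable_comp (D : set R) (g : R -> E) (h : E -> R) :
  measurable D -> strongly_measurable D g -> continuous h ->
  measurable_fun D (h \o g).
Proof.
by move=> mD sg ch; apply: (measurable_caratheodory (q := fun=> h)).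
Qed.

Lemma lebesgue_measure_oo_lty (a b : R) : (mu `]a, b[ < +oo)%E.
Proof. by rewrite lebesgue_measure_itv/=; case: ifPn; rewrite ?ltry. Qed.

Lemma integrable_bochner_comp (D : set R) (h : E -> R) (c : R) (g : R -> E) :
  measurable D -> strongly_measurable D g -> continuous h ->
  (forall x, `|h x| <= c * `|x|) ->
  mu.-integrable D (EFin \o (fun r => `|g r|)) ->
  mu.-integrable D (EFin \o (h \o g)).
Proof.
move=> mD sg ch hc ig.
apply: (integrable_le (g := fun r => c * `|g r|)) => //.
- exact: strongly_measurable_comp.
- by move=> r _; exact: hc.
- exact: integrable_scale.
Qed.

Lemma integrable_dual (D : set R) (phi : dual_space E) (g : R -> E) :
  measurable D -> strongly_measurable D g ->
  mu.-integrable D (EFin \o (fun r => `|g r|)) ->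
  mu.-integrable D (EFin \o (phi \o g)).
Proof.
move=> mD sg; apply: (@integrable_bochner_comp _ phi (opnorm phi)) => //.
- exact: clin_continuous.
- exact: opnorm_ub.
Qed.

(** On simple functions a functional commutes with the integral by linearity;
along an approximating sequence both sides converge, the right one because the
functional is bounded and the sequence converges in L^1. *)
Lemma bochner_dual (phi : dual_space E) (a b : R) (g : R -> E) (x : E) :
  is_bochner_integral a b g x ->
  mu.-integrable `]a, b[ (EFin \o (fun r => `|g r|)) ->
  phi x = \int[mu]_(r in `]a, b[) phi (g r).
Proof.
move=> [sg [s [ss gs sx]]] ig.
have mI : measurable (`]a, b[ : set R) by exact: measurable_itv.
have Ifin := lebesgue_measure_oo_lty a b.
have iphi := integrable_dual phi mI sg ig.
have isphi n : mu.-integrable `]a, b[ (EFin \o (phi \o s n)).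
  exact: integrable_simple.
have ign n : mu.-integrable `]a, b[ (EFin \o (fun r => `|g r - s n r|)).
  apply: (integrable_le (g := fun r => `|g r| + `|s n r|)) => //.
  - apply: (measurable_caratheodory (q := fun r y => `|y - s n r|)) => //.
    + move=> y; apply: (measurable_simple_comp (q := fun=> fun z => `|y - z|)) => //.
    + by move=> r _ y; apply: cvg_norm; apply: cvgB; [exact: cvg_id|exact: cvg_cst].
  - by move=> r _; rewrite normr_id ler_normB.
  - apply: (integrable_add mI ig).
    exact: (integrable_simple (fun y => `|y|)).
have cvg1 : (fun n => phi (simple_integral a b (s n)) : R) @ \oo --> (phi x : R).
  by apply: continuous_cvg => //; exact: clin_continuous.
have cvg2 : (fun n => \int[mu]_(r in `]a, b[) phi (s n r) : R) @ \oo -->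
    (\int[mu]_(r in `]a, b[) phi (g r) : R).
  apply/cvgrPdist_le => e e0.
  have c0 : (fun n => opnorm phi * \int[mu]_(r in `]a, b[) `|g r - s n r|) @ \oo
      --> (0 : R).
    rewrite -(mulr0 (opnorm phi)); apply: cvgMr => //.
    exact: (fine_cvg gs).
  move/cvgrPdist_le : c0 => /(_ _ e0); apply: filterS => n.
  rewrite sub0r normrN; apply: le_trans; apply: (le_trans _ (ler_norm _)).
  rewrite -RintegralZl//.
  apply: (normr_RintegralB_le (f := phi \o g) (g := phi \o s n)
    (h := fun r => opnorm phi * `|g r - s n r|)) => //.
    exact: integrable_scale.
  by move=> r _; rewrite -clinB opnorm_ub.
have eqs : (fun n => phi (simple_integral a b (s n))) =
    (fun n => \int[mu]_(r in `]a, b[) phi (s n r)).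
  by apply/funext => k; exact: simple_integral_dual.
rewrite eqs in cvg1.
exact: etrans (esym (cvg_lim (@Rhausdorff R) cvg1)) (cvg_lim (@Rhausdorff R) cvg2).
Qed.

End bochner.

(** * Calculus of H^1 curves *)

Section intervals.
Context {R : realType}.
Local Notation mu := (@lebesgue_measure R).

Lemma subset_oo (a b c d : R) : c <= a -> b <= d ->
  (`]a, b[ : set R) `<=` `]c, d[.
Proof. by move=> ca bd; apply: subset_itv; rewrite bnd_simp. Qed.

Lemma integrable_oo (a b c d : R) (f : R -> R) : c <= a -> b <= d ->
  mu.-integrable `]c, d[ (EFin \o f) -> mu.-integrable `]a, b[ (EFin \o f).
Proof. by move=> ca bd; apply: integrableS => //; exact: subset_oo. Qed.

Lemma integrable_cst_oo (a b c : R) : mu.-integrable `]a, b[ (EFin \o (fun=> c)).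
Proof.
apply: measurable_bounded_integrable => //; first exact: lebesgue_measure_oo_lty.
exists `|c|; split; first exact: num_real.
by move=> M cM r _; exact: ltW.
Qed.

Lemma Rintegral_cst_oo (a b c : R) : a <= b ->
  \int[mu]_(r in `]a, b[) c = (b - a) * c.
Proof.
move=> ab; rewrite Rintegral_cst// mulrC; congr (_ * _).
transitivity (fine (mu `]a, b[)); first by [].
rewrite lebesgue_measure_itv/= lte_fin.
by case: ltgtP ab => //= ->; rewrite subrr.
Qed.

Lemma Rintegral_oo_chasles (f : R -> R) (T a b : R) :
  0 <= a -> a <= b -> b <= T -> mu.-integrable `]0, T[ (EFin \o f) ->
  \int[mu]_(r in `]0, b[) f r =
  \int[mu]_(r in `]0, a[) f r + \int[mu]_(r in `]a, b[) f r.
Proof.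
move=> a0 + bT intf; rewrite le_eqVlt => /predU1P[<-|ab].
  by rewrite set_itvoo0 Rintegral_set0 addr0.
have ifb : mu.-integrable `]0, b[ (EFin \o f) by exact: integrable_oo intf.
have ifa : mu.-integrable `]0, a[ (EFin \o f).
  by apply: integrable_oo intf => //; exact: le_trans (ltW ab) bT.
have := @Rintegral_itvB R f (BRight 0) (BLeft b) a ifb.
rewrite !bnd_simp => /(_ a0 ab) <-.
by rewrite -Rintegral_itv_bndo_bndc// addrC subrK.
Qed.

End intervals.

Section H1.
Context {R : realType} {E : normedModType R}.
Local Notation mu := (@lebesgue_measure R).
Variables (T : R) (u du : R -> E).
Hypothesis hu : in_H1 T u du.

Lemma H1_strongly_measurable : strongly_measurable `]0, T[ du.
Proof. by case: hu => -[]. Qed.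

(** On a bounded interval L^2 is contained in L^1, since |x| <= 1 + |x|^2. *)
Lemma H1_integrable_norm : mu.-integrable `]0, T[ (EFin \o (fun r => `|du r|)).
Proof.
have [[sm L2] _] := hu.
have mn2 : measurable_fun `]0, T[ (fun r => `|du r| ^+ 2).
  apply: measurable_realfun.measurable_funX.
  apply: (strongly_measurable_comp (h := fun x => `|x|)) => //.
  exact: norm_continuous.
apply: (@integrable_le _ _ _ (fun r => 1 + `|du r| ^+ 2)) => //.
- apply: (strongly_measurable_comp (h := fun x => `|x|)) => //.
  exact: norm_continuous.
- move=> r _; rewrite normr_id; have := sqr_ge0 (`|du r| - 1); rewrite sqrrB1; nra.
- apply: integrable_add => //; first exact: integrable_cst_oo.
  apply/integrableP; split; first exact/measurable_realfun.measurable_EFinP.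
  apply: le_lt_trans L2; rewrite le_eqVlt; apply/orP; left; apply/eqP.
  by apply: eq_integral => r _; rewrite gee0_abs//= lee_fin exprn_ge0.
Qed.

Lemma H1_integrable_dist (c : E) :
  mu.-integrable `]0, T[ (EFin \o (fun r => `|du r - c|)).
Proof.
apply: (@integrable_le _ _ _ (fun r => `|du r| + `|c|)) => //.
- apply: (strongly_measurable_comp (h := fun x => `|x - c|)) => //.
    exact: H1_strongly_measurable.
  by move=> x; apply: cvg_norm; apply: cvgB; [exact: cvg_id|exact: cvg_cst].
- by move=> r _; rewrite normr_id ler_normB.
- apply: integrable_add => //; first exact: H1_integrable_norm.
  exact: integrable_cst_oo.
Qed.

Lemma H1_integrable_dual (phi : dual_space E) :
  mu.-integrable `]0, T[ (EFin \o (phi \o du)).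
Proof.
apply: integrable_dual => //; first exact: H1_strongly_measurable.
exact: H1_integrable_norm.
Qed.

Lemma H1_dual (phi : dual_space E) (a b : R) : 0 <= a -> a <= b -> b <= T ->
  phi (u b) - phi (u a) = \int[mu]_(r in `]a, b[) phi (du r).
Proof.
move=> a0 ab bT.
have P t : 0 <= t -> t <= T ->
    phi (u t) - phi (u 0) = \int[mu]_(r in `]0, t[) phi (du r).
  move=> t0 tT; rewrite -clinB; apply: bochner_dual.
    by case: hu => _; apply; rewrite t0.
  exact: integrable_oo H1_integrable_norm.
have := Rintegral_oo_chasles a0 ab bT (H1_integrable_dual phi).
rewrite /= -(P b (le_trans a0 ab) bT) -(P a a0 (le_trans ab bT)).
have sub_chasles (x y z w : R) : x - y = z - y + w -> x - z = w by lra.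
exact: sub_chasles.
Qed.

(** Comparison with a line of arbitrary slope c: c = 0 gives absolute
continuity, and c close to [du] at a point gives differentiability there. *)
Lemma H1_increment_le (c : E) (a b : R) : norming_dual E ->
  0 <= a -> a <= b -> b <= T ->
  `|u b - u a - (b - a) *: c| <= \int[mu]_(r in `]a, b[) `|du r - c|.
Proof.
move=> nE a0 ab bT; apply: nE => phi phi1.
rewrite !clinB clinZ H1_dual//.
have -> : (b - a) *: phi c = \int[mu]_(r in `]a, b[) phi c.
  by rewrite Rintegral_cst_oo.
apply: (le_trans (ler_norm _)); apply: normr_RintegralB_le => //.
- exact: integrable_oo (H1_integrable_dual phi).
- exact: integrable_cst_oo.
- exact: integrable_oo (H1_integrable_dist c).
- by move=> r _; rewrite -clinB.
Qed.

Lemma H1_dist_le (a b : R) : norming_dual E -> 0 <= a -> a <= b -> b <= T ->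
  `|u b - u a| <= \int[mu]_(r in `]a, b[) `|du r|.
Proof.
move=> nE a0 ab bT; have := H1_increment_le 0 nE a0 ab bT.
rewrite scaler0 subr0 => /le_trans; apply; rewrite le_eqVlt; apply/orP; left.
by apply/eqP; apply: eq_Rintegral => r _; rewrite subr0.
Qed.

End H1.

Section increments.
Context {R : realType} {E : normedModType R}.

(** Differentiability as an increment estimate: in this form estimates add up
without division, and the increment zero needs no separate treatment. *)
Lemma is_derive_incrementP (f : R -> E) (t : R) (d : E) :
  is_derive t 1 f d <-> forall e : R, 0 < e ->
    \forall h \near (0 : R), `|f (h + t) - f t - h *: d| <= e * `|h|.
Proof.
have quotient (h : R) : h != 0 ->
    `|d - h^-1 *: (f (h + t) - f t)| * `|h| = `|f (h + t) - f t - h *: d|.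
  move=> h0; rewrite mulrC -normrZ scalerBr scalerA mulfV// scale1r.
  by rewrite distrC.
pose D (h : R) := h^-1 *: (f (h + t) - f t).
have DE : (fun h : R => h^-1 *: ((f \o shift t) (h *: (1 : R)) - f t)) = D.
  by apply/funext => h; rewrite /D /= [h *: _]mulr1.
split=> [[df Df] e e0|H].
  have /cvgrPdist_le/(_ _ e0) : D h @[h --> (0:R)^'] --> d.
    by move: df; rewrite /derivable DE => df; rewrite -Df /derive DE; exact: df.
  move=> He0; have He : \forall h \near (0:R), h != 0 -> `|d - D h| <= e := He0.
  near=> h; have [->|h0] := eqVneq h 0.
    by rewrite add0r scale0r !subrr !normr0 mulr0.
  rewrite -quotient// ler_wpM2r//.
  by move: h0; near: h.
have cD : D h @[h --> (0:R)^'] --> d.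
  apply/cvgrPdist_le => e e0.
  suff He : \forall h \near (0:R), h != 0 -> `|d - D h| <= e by exact: He.
  apply: filterS (H _ e0) => h /[swap] h0.
  by rewrite -quotient// ler_pM2r// normr_gt0.
split; first by rewrite /derivable DE; apply/cvg_ex; exists d.
by rewrite /derive DE; apply: cvg_lim => //.
Unshelve. all: by end_near. Qed.

End increments.

Section differentiation.
Context {R : realType}.
Local Notation mu := (@lebesgue_measure R).

(** Lebesgue's differentiation theorem for the extension of f by zero. *)
Lemma ae_is_derive_Rintegral (T : R) (f : R -> R) :
  mu.-integrable `]0, T[ (EFin \o f) ->
  {ae mu, forall t : R, t \in `]0, T[ ->
    is_derive t 1 (fun x => \int[mu]_(r in `]0, x[) f r) (f t)}.
Proof.
move=> intf; pose g := f \_ `]0, T[.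
have mI : measurable (`]0, T[ : set R) by exact: measurable_itv.
have intg : mu.-integrable setT (EFin \o g).
  by rewrite /g -restrict_EFin; apply/integrable_restrict => //; rewrite setTI.
have intg' (D : set R) : measurable D -> mu.-integrable D (EFin \o g).
  by move=> mD; exact: integrableS intg.
have := @FTC1 R g (BRight 0) (fun y => intg' _ (measurable_itv _))
  (integrable_locally_restrict mI intf).
apply: filterS; first exact: (ae_filter_ringOfSetsType mu).
move=> t Ht tI.
have /andP[t0 tT] : 0 < t < T by move: tI; rewrite in_itv.
have [] := Ht _; first by rewrite /= lte_fin.
set G := (fun x : R => _) => dG.
have gt : g t = f t by rewrite /g patchE mem_set.
rewrite derive1E gt => G't.
have : is_derive t 1 G (f t) by apply: DeriveDef.
apply: near_eq_is_derive.
near=> x.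
have /andP[x0 xT] : 0 < x < T.
  apply/andP; split; near: x; [exact: lt_nbhsr|exact: lt_nbhsl].
rewrite /G -Rintegral_itv_bndo_bndc; last exact: intg'.
apply: eq_Rintegral => r; rewrite inE/= in_itv/= => /andP[r0 rx].
by rewrite /g patchE mem_set//= in_itv/= r0 (lt_trans rx).
Unshelve. all: by end_near. Qed.

End differentiation.

Section H1_differentiation.
Context {R : realType} {E : normedModType R}.
Local Notation mu := (@lebesgue_measure R).

Lemma H1_increment_primitive (T : R) (u du : R -> E) (c : E) (a b : R) :
  norming_dual E -> in_H1 T u du -> 0 <= a <= T -> 0 <= b <= T ->
  `|u b - u a - (b - a) *: c| <=
  `|\int[mu]_(r in `]0, b[) `|du r - c| - \int[mu]_(r in `]0, a[) `|du r - c| |.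
Proof.
move=> nE hu; wlog ab : a b / a <= b.
  move=> wl aT bT; have [ab|/ltW ba] := leP a b; first exact: wl.
  rewrite [leRHS]distrC; apply: le_trans (wl b a ba bT aT).
  rewrite -[leRHS]normrN opprB (opprB (u a) (u b)) -(opprB a b) scaleNr opprK.
  by rewrite [X in _ <= `|X|]addrC.
move=> aI bI; have /andP[a0 _] := aI; have /andP[_ bT] := bI.
apply: (le_trans (H1_increment_le hu c nE a0 ab bT)).
have := Rintegral_oo_chasles a0 ab bT (H1_integrable_dist hu c).
by move=> ->; rewrite addrAC subrr add0r ler_norm.
Qed.

(** A strongly measurable curve has values in the closure of a countable set,
that of the values c of the approximating simple functions. Each real function
r |-> |du r - c| is the almost everywhere derivative of its primitive, so
almost every t is good for all the c at once. At such a t the increments of u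
differ from those of slope c by about |du t - c| |h|, and c can be chosen as
close to [du t] as one wishes. *)
Lemma H1_ae_is_derive (T : R) (u du : R -> E) :
  norming_dual E -> in_H1 T u du ->
  {ae mu, forall t : R, t \in `]0, T[ -> is_derive t 1 u (du t)}.
Proof.
move=> nE hu; have [s ss sdu] := H1_strongly_measurable hu.
have /choice[S rS] n : exists S : seq E, range (s n) = [set` S].
  by apply/finite_seqP; case: (ss n).
have : {ae mu, forall t : R, forall n k : nat, t \in `]0, T[ ->
    is_derive t 1 (fun x => \int[mu]_(r in `]0, x[) `|du r - nth 0 (S n) k|)
      `|du t - nth 0 (S n) k|}.
  apply: ae_foralln => n; apply: ae_foralln => k.
  exact: ae_is_derive_Rintegral (H1_integrable_dist hu _).
apply: filterS; first exact: (ae_filter_ringOfSetsType mu).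
move=> t Ht tI.
have /andP[t0 tT] : 0 < t < T by move: tI; rewrite in_itv.
apply/is_derive_incrementP => e e0.
(* one third for the increments of the primitive, two for |du t - c| *)
have e3 : 0 < e / 3 by rewrite divr_gt0.
have [n sn] : exists n, `|du t - s n t| <= e / 3.
  have := sdu t tI; move/cvgrPdist_le => /(_ _ e3) [n _ Hn].
  by exists n; apply: Hn => /=.
have [k ck] : exists k, nth 0 (S n) k = s n t.
  have sS : s n t \in S n.
    by change ([set` S n] (s n t)); rewrite -rS; exists t.
  by exists (index (s n t) (S n)); rewrite nth_index.
have := Ht n k tI; rewrite ck => /is_derive_incrementP/(_ _ e3) HK.
near=> h.
have hT : 0 <= h + t <= T.
  apply/andP; split.
    rewrite -lerBlDr sub0r ltW//; near: h; apply: lt_nbhsr.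
    by rewrite oppr_lt0.
  rewrite -lerBrDr ltW//; near: h; apply: lt_nbhsl.
  by rewrite subr_gt0.
have := H1_increment_primitive (s n t) nE hu (a := t) (b := h + t) _ hT.
rewrite (ltW t0) (ltW tT) => /(_ isT)/=.
rewrite addrK => h1.
have h2 : `|\int[mu]_(r in `]0, h + t[) `|du r - s n t| -
   \int[mu]_(r in `]0, t[) `|du r - s n t| - h *: `|du t - s n t| | <= e / 3 * `|h|.
  by near: h.
have -> : u (h + t) - u t - h *: du t =
    (u (h + t) - u t - h *: s n t) + h *: (s n t - du t).
  by rewrite scalerBr addrA subrK.
apply: (le_trans (ler_normD _ _)).
rewrite normrZ (distrC (s n t)).
move: h1 h2; set x := `|u _ - _ - _|; set y := _ - _; set z := `|du t - s n t| in sn *.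
move=> xy yz.
have : `|y| <= e / 3 * `|h| + `|h| * z.
  rewrite -[y](subrK (h * z)); apply: (le_trans (ler_normD _ _)); apply: lerD => //.
  by rewrite normrM normr_id.
have := ler_wpM2l (normr_ge0 h) sn.
lra.
Unshelve. all: by end_near. Qed.

End H1_differentiation.

Section primitive.
Context {R : realType}.
Local Notation mu := (@lebesgue_measure R).

Lemma Rintegral_oo_continuous (T : R) (f : R -> R) : 0 <= T ->
  mu.-integrable `]0, T[ (EFin \o f) ->
  {within `[0, T], continuous (fun x => \int[mu]_(r in `]0, x[) f r)}.
Proof.
move=> T0 intf; pose g := f \_ `]0, T[.
have mI : measurable (`]0, T[ : set R) by exact: measurable_itv.
have intg : mu.-integrable setT (EFin \o g).
  by rewrite /g -restrict_EFin; apply/integrable_restrict => //; rewrite setTI.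
have intg' (D : set R) : measurable D -> mu.-integrable D (EFin \o g).
  by move=> mD; exact: integrableS intg.
apply: subspace_eq_continuous; last first.
  exact: parameterized_integral_continuous T0 (intg' _ (measurable_itv _)).
move=> x; rewrite inE/= in_itv/= => /andP[x0 xT].
rewrite /from_subspace /parameterized_integral -Rintegral_itv_bndo_bndc; last exact: intg'.
rewrite -Rintegral_itv_obnd_cbnd; last exact: intg'.
apply: eq_Rintegral => r; rewrite inE/= in_itv/= => /andP[r0 rx].
by rewrite /g patchE mem_set//= in_itv/= r0 (lt_le_trans rx).
Qed.

(** The intermediate value theorem halves the increment of K; the square then
makes the sum over the two halves half as large. Iterating, the increment of
psi is at most C (K b - K a)^2 / 2^n for all n. Halving the range of K instead
of the interval avoids any uniform continuity. *)
Lemma quadratic_increment_cst (T C : R) (psi K : R -> R) :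
  {within `[0, T], continuous K} ->
  (forall a b, 0 <= a -> a <= b -> b <= T ->
    `|psi b - psi a| <= C * (K b - K a) ^+ 2) ->
  forall t, 0 <= t <= T -> psi t = psi 0.
Proof.
move=> cK psiK.
have H n : forall a b, 0 <= a -> a <= b -> b <= T ->
    `|psi b - psi a| <= C * (K b - K a) ^+ 2 / 2 ^+ n.
  elim: n => [|n IH] a b a0 ab bT; first by rewrite expr0 divr1 psiK.
  have cKab : {within `[a, b], continuous K}.
    apply: continuous_subspaceW cK => r /=; rewrite !in_itv/= => /andP[ar rb].
    by rewrite (le_trans a0 ar) (le_trans rb bT).
  have [|c] := IVT ab cKab (v := (K a + K b) / 2).
    by rewrite ge_min le_max; lra.
  rewrite in_itv/= => /andP[ac cb] Kc.
  have h1 := IH a c a0 ac (le_trans cb bT).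
  have h2 := IH c b (le_trans a0 ac) cb bT.
  apply: (le_trans (ler_distD (psi c) _ _)).
  apply: (le_trans (lerD h2 h1)); rewrite -mulrDl -mulrDr.
  have -> : (K b - K c) ^+ 2 + (K c - K a) ^+ 2 = (K b - K a) ^+ 2 / 2.
    by rewrite Kc; field.
  by rewrite [2 ^+ n.+1]exprS le_eqVlt; apply/orP; left; apply/eqP; rewrite invfM; ring.
move=> t /andP[t0 tT]; apply/eqP; rewrite -subr_eq0 -normr_le0.
have c0 : (fun n => C * (K t - K 0) ^+ 2 / 2 ^+ n) @ \oo --> (0 : R).
  have := @cvg_geometric R (C * (K t - K 0) ^+ 2) 2^-1.
  rewrite ger0_norm// invf_lt1// ltr1n => /(_ isT).
  by under eq_cvg do rewrite /= exprVn.
by apply: (cvgr_to_ge c0); near=> n; exact: H.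
Unshelve. all: by end_near. Qed.

End primitive.

Section continuity.
Context {R : realType} {E : normedModType R}.
Local Notation mu := (@lebesgue_measure R).
Variables (T : R) (u du : R -> E).
Hypothesis T0 : 0 <= T.
Hypothesis nE : norming_dual E.
Hypothesis hu : in_H1 T u du.

Lemma H1_dist_primitive (a b : R) : 0 <= a <= T -> 0 <= b <= T ->
  `|u b - u a| <=
  `|\int[mu]_(r in `]0, b[) `|du r| - \int[mu]_(r in `]0, a[) `|du r| |.
Proof.
move=> aI bI; have := H1_increment_primitive 0 nE hu aI bI.
have E0 x : \int[mu]_(r in `]0, x[) `|du r - 0| = \int[mu]_(r in `]0, x[) `|du r|.
  by apply: eq_Rintegral => r _; rewrite subr0.
by rewrite scaler0 subr0 !E0.
Qed.

Lemma H1_continuous : {within `[0, T], continuous u}.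
Proof.
have := Rintegral_oo_continuous T0 (H1_integrable_norm hu).
move=> /subspace_continuousP cK; apply/subspace_continuousP => x xI.
apply/cvgrPdist_lt => e e0.
have /cvgrPdist_lt/(_ _ e0) := cK x xI.
rewrite !near_withinE; apply: filterS => y Hy yI.
have xT : 0 <= x <= T by move: xI; rewrite /= in_itv.
have yT : 0 <= y <= T by move: yI; rewrite /= in_itv.
apply: (le_lt_trans (H1_dist_primitive yT xT)); exact: Hy.
Qed.

Lemma continuous_within_measurable (f : R -> R) :
  {within `[0, T], continuous f} -> measurable_fun (`]0, T[ : set R) f.
Proof.
move=> cf; apply: (@measurable_funS _ _ _ _ `[0, T]) => //.
  exact: subset_itv_oo_cc.
exact: measurable_realfun.subspace_continuous_measurable_fun.
Qed.

End continuity.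

Lemma within_continuous_post {R : realType} {S S' : topologicalType} (A : set R)
  (f : R -> S) (g : S -> S') :
  {within A, continuous f} -> continuous g -> {within A, continuous (g \o f)}.
Proof. by move=> cf cg; apply: within_continuous_comp => // x _; exact: cg. Qed.

(** Evaluation is jointly continuous: both factors are controlled in norm. *)
Lemma within_continuous_eval {R : realType} {E G : normedModType R} (A : set R)
    (f : R -> clin E G) (v : R -> E) :
  {within A, continuous f} -> {within A, continuous v} ->
  {within A, continuous (fun r => f r (v r))}.
Proof.
move=> /subspace_continuousP cf /subspace_continuousP cv.
apply/subspace_continuousP => x Ax.
have cfx : `|f x - f y| @[y --> within A (nbhs x)] --> (0 : R).
  rewrite -(normr0 (clin E G)) -(subrr (f x)); apply: cvg_norm.
  by apply: cvgB; [exact: cvg_cst|exact: cf].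
have cvx : `|v x - v y| @[y --> within A (nbhs x)] --> (0 : R).
  rewrite -(normr0 E) -(subrr (v x)); apply: cvg_norm.
  by apply: cvgB; [exact: cvg_cst|exact: cv].
have nv : `|v y| @[y --> within A (nbhs x)] --> `|v x| by apply: cvg_norm; exact: cv.
have c0 : `|f x| * `|v x - v y| + `|f x - f y| * `|v y| @[y --> within A (nbhs x)] --> (0 : R).
  rewrite -[X in _ --> X](_ : `|f x| * 0 + 0 * `|v x| = 0); last first.
    by rewrite mulr0 mul0r addr0.
  by apply: cvgD; apply: cvgM => //; exact: cvg_cst.
apply/cvgrPdist_le => e e0.
move/cvgrPdist_le : c0 => /(_ _ e0); apply: filterS => y.
rewrite sub0r normrN; apply: le_trans; apply: (le_trans _ (ler_norm _)).
have -> : f x (v x) - f y (v y) = f x (v x - v y) + (f x - f y) (v y).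
  by rewrite clinB add_clinE opp_clinE addrA subrK.
apply: (le_trans (ler_normD _ _)); apply: lerD.
  exact: (opnorm_ub (f x)).
exact: (opnorm_ub (f x - f y)).
Qed.

Local Lemma half_sum_le {R : realType} (x y p q ka kr kb : R) :
  x <= p -> y <= q -> kb = kr + q -> kr = ka + p -> 0 <= p -> 0 <= q ->
  2^-1 * x + 2^-1 * y <= kb - ka.
Proof. lra. Qed.

Section quadratic.
Context {R : realType} {E : normedModType R}.
Local Notation mu := (@lebesgue_measure R).
Variables (T : R) (u du : R -> E).
Hypothesis T0 : 0 <= T.
Hypothesis nE : norming_dual E.
Hypothesis hu : in_H1 T u du.

(** The pairing is measurable by Caratheodory's argument and dominated by a
multiple of |du|. *)
Lemma H1_integrable_pairing (q : R -> E -> R) (M : R) :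
  (forall x, measurable_fun (`]0, T[ : set R) (q ^~ x)) ->
  (forall r, continuous (q r)) ->
  (forall r x, 0 <= r <= T -> `|q r x| <= M * `|x|) ->
  mu.-integrable `]0, T[ (EFin \o (fun r => q r (du r))).
Proof.
move=> mq cq qM.
have sdu := H1_strongly_measurable hu.
apply: (@integrable_le _ _ _ (fun r => M * `|du r|)) => //.
- exact: measurable_caratheodory.
- by move=> r; rewrite /= in_itv/= => /andP[r0 rT]; apply: qM; rewrite !ltW.
- by apply: integrable_scale => //; exact: H1_integrable_norm hu.
Qed.

Lemma H1_bounded : exists M : R, forall r, 0 <= r <= T -> `|u r| <= M.
Proof.
have /compact_bounded[M [_ HM]] :=
  continuous_compact (H1_continuous T0 nE hu) (@segment_compact _ 0 T).
exists (M + 1) => r rT; apply: (HM (M + 1)); first by rewrite ltrDl.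
by exists r => //=; rewrite in_itv.
Qed.

Variable B : clin E (dual_space E).

Lemma H1_integrable_bilinear :
  mu.-integrable `]0, T[ (EFin \o (fun r => B (u r) (du r))).
Proof.
have [M uM] := H1_bounded.
apply: (H1_integrable_pairing (q := fun r x => B (u r) x) (M := `|B| * M)).
- move=> x; apply: continuous_within_measurable.
  apply: within_continuous_eval; last exact: cst_continuous.
  by apply: within_continuous_post; [exact: H1_continuous hu|exact: clin_continuous].
- by move=> r; exact: clin_continuous.
- move=> r x rT; apply: (le_trans (bilinear_norm_le B (u r) x)).
  by rewrite ler_wpM2r// ler_wpM2l// uM.
Qed.

Hypothesis symB : forall x y, B x y = B y x.

(** On a short interval from a to b the increment of the left-hand side is
exactly the integral of [du] against the functional of the midpoint (u a + u
b) / 2, by symmetry of B. Replacing the midpoint by [u r] costs at most |B| (K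
b - K a)^2, where K is the primitive of |du|, because K also bounds the
increments of u. Hence the difference of the two sides has increments
quadratic in those of K, and is constant. *)
Lemma H1_quadratic (t : R) : 0 <= t <= T ->
  2^-1 * B (u t) (u t) - 2^-1 * B (u 0) (u 0) =
  \int[mu]_(r in `]0, t[) B (u r) (du r).
Proof.
move=> tT.
pose psi t := 2^-1 * B (u t) (u t) - \int[mu]_(r in `]0, t[) B (u r) (du r) : R.
pose K t := \int[mu]_(r in `]0, t[) `|du r|.
suff : psi t = psi 0.
  rewrite /psi set_itvoo0 Rintegral_set0 subr0.
  set x := (\int[_]_(_ in _) _) => <-; ring.
apply: (@quadratic_increment_cst _ T (`|B|) psi K) tT.
  exact: Rintegral_oo_continuous (H1_integrable_norm hu).
move=> a b a0 ab bT.
have intK := H1_integrable_norm hu.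
have KE := Rintegral_oo_chasles a0 ab bT intK.
have IE := Rintegral_oo_chasles a0 ab bT H1_integrable_bilinear.
pose phi := 2^-1 *: B (u a + u b).
have phiE x : phi x = 2^-1 * (B (u a) x + B (u b) x).
  by rewrite /phi scale_clinE clinD.
have -> : psi b - psi a = \int[mu]_(r in `]a, b[) phi (du r) -
    \int[mu]_(r in `]a, b[) B (u r) (du r).
  rewrite -(H1_dual hu)// /psi IE !phiE (symB (u b) (u a)); lra.
have Kba : \int[mu]_(r in `]a, b[) `|du r| = K b - K a.
  by rewrite /K KE addrAC subrr add0r.
have -> : `|B| * (K b - K a) ^+ 2 =
    \int[mu]_(r in `]a, b[) ((`|B| * (K b - K a)) * `|du r|).
  rewrite RintegralZl//; last exact: integrable_oo intK.
  by rewrite Kba expr2 mulrA.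
apply: normr_RintegralB_le => //.
- exact: integrable_oo (H1_integrable_dual hu phi).
- exact: integrable_oo H1_integrable_bilinear.
- by apply: integrable_scale => //; exact: integrable_oo intK.
move=> r; rewrite /= in_itv/= => /andP[ar rb].
have -> : phi (du r) - B (u r) (du r) =
    B (2^-1 *: (u a - u r) + 2^-1 *: (u b - u r)) (du r).
  rewrite phiE clinD !clinZ !clinB !(add_clinE, scale_clinE, opp_clinE).
  by rewrite -![_ *: (_ : R^o)]/(_ * _); field.
apply: (le_trans (bilinear_norm_le B _ _)).
rewrite ler_wpM2r// ler_wpM2l//.
apply: (le_trans (ler_normD _ _)); rewrite !normrZ ger0_norm ?invr_ge0//.
have rT : r <= T by rewrite (le_trans (ltW rb)).
have r0 : 0 <= r by rewrite (le_trans a0)// ltW.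
have h1 := H1_dist_le hu nE a0 (ltW ar) rT.
have h2 := H1_dist_le hu nE r0 (ltW rb) bT.
have KE1 := Rintegral_oo_chasles a0 (ltW ar) rT intK.
have KE2 := Rintegral_oo_chasles r0 (ltW rb) bT intK.
have p1 : 0 <= \int[mu]_(r0 in `]a, r[) `|du r0| by apply: Rintegral_ge0.
have p2 : 0 <= \int[mu]_(r0 in `]r, b[) `|du r0| by apply: Rintegral_ge0.
rewrite (distrC (u a)) /K; exact: half_sum_le h1 h2 KE2 KE1 p1 p2.
Qed.

End quadratic.

(** * Real functions on an interval *)

Section real_lemmas.
Context {R : realType}.
Local Notation mu := (@lebesgue_measure R).

Lemma le_of_le_addM (a b c : R) :
  (forall tau, 0 < tau -> tau <= 1 -> a <= b + tau * c) -> a <= b.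
Proof.
move=> H; apply/ler_addgt0Pr => e e0.
have c1 : 0 < `|c| + 1 by rewrite ltr_wpDl.
(* any tau <= 1 with tau * |c| <= e will do *)
pose tau := Num.min 1 (e / (`|c| + 1)).
have tau0 : 0 < tau by rewrite lt_min ltr01 divr_gt0.
apply: (le_trans (H tau tau0 _)); first by rewrite ge_min lexx.
rewrite lerD2l; apply: (@le_trans _ _ (tau * (`|c| + 1))).
  by rewrite ler_pM2l// (le_trans (ler_norm c))// lerDl.
by rewrite -ler_pdivlMr// ge_min lexx orbT.
Qed.

(** Differentiability is known at the single point t, so this is the two-sided
increment estimate at t + h and t - h rather than a mean value argument. *)
Lemma is_derive_local_max (g : R -> R) (t d : R) : is_derive t 1 g d ->
  (\forall s \near t, g s <= g t) -> d = 0.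
Proof.
move=> /is_derive_incrementP H gmax.
apply/eqP; rewrite -normr_le0; apply/ler_addgt0Pr => e e0; rewrite add0r.
have [r r0 Hr] := H _ e0.
have [r' r'0 Hr'] := gmax.
pose h := Num.min r r' / 2.
have m0 : 0 < Num.min r r' by rewrite lt_min; apply/andP.
have m1 : Num.min r r' <= r by rewrite ge_min lexx.
have m2 : Num.min r r' <= r' by rewrite ge_min lexx orbT.
have [h0 hr hr'] : [/\ 0 < h, h < r & h < r'] by rewrite /h; split; lra.
have P (k : R) : `|k| = h -> k * d <= e * h.
  move=> kh.
  have h1 : `|g (k + t) - g t - k * d| <= e * `|k|.
    by apply: Hr; rewrite /= sub0r normrN kh.
  have h2 : g (k + t) <= g t.
    by apply: Hr'; rewrite /= opprD addrCA subrr addr0 normrN kh.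
  by move: h1; rewrite kh ler_norml => /andP[h1 _]; lra.
have := P h; have := P (- h); rewrite normrN gtr0_norm// => /(_ erefl) h1 /(_ erefl) h2.
rewrite ler_norml -(ler_pM2l h0) -(ler_pM2l h0 d).
by apply/andP; split; clear -h1 h2; lra.
Qed.

(** If f t > 0 then f > 0 on a nondegenerate interval, which is not a null
set. *)
Lemma ae_le0_within (T : R) (f : R -> R) : 0 < T ->
  {within `[0, T], continuous f} ->
  {ae mu, forall t : R, t \in `]0, T[ -> f t <= 0} ->
  forall t, 0 <= t <= T -> f t <= 0.
Proof.
move=> T0 /subspace_continuousP cf [N [mN N0 HN]] t /andP[t0 tT].
rewrite leNgt; apply/negP => ft.
have tI : `[0, T]%classic t by rewrite /= in_itv/= t0.
have := cvgr_gt _ (cf t tI) _ ft.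
rewrite near_withinE => -[r r0' Hr]; have r0 : 0 < r := r0'.
pose a := Num.max 0 (t - r); pose b := Num.min T (t + r).
have ab : a < b.
  by rewrite lt_min !gt_max; apply/andP; split; apply/andP; split; lra.
have sub : (`]a, b[ : set R) `<=` N.
  move=> s; rewrite /= in_itv/= => /andP[].
  rewrite gt_max lt_min => /andP[s0 sr] /andP[sT sr'].
  apply: HN => /= /(_ _)/wrap[]; first by rewrite in_itv/= s0.
  move=> fs; have : 0 < f s.
    apply: Hr; first by rewrite /= ltr_distlC; apply/andP; split; lra.
    by rewrite /= in_itv/= !ltW.
  by rewrite ltNge fs.
have : (mu `]a, b[ <= mu N)%E by apply: le_measure => //; rewrite inE//.
rewrite N0 lebesgue_measure_itv/= lte_fin ab -EFinD lee_fin.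
by rewrite leNgt subr_gt0 ab.
Qed.

Lemma Rintegral_ae_eq (D : set R) (f g : R -> R) : measurable D ->
  mu.-integrable D (EFin \o f) -> mu.-integrable D (EFin \o g) ->
  {ae mu, forall r, D r -> f r = g r} ->
  \int[mu]_(r in D) f r = \int[mu]_(r in D) g r.
Proof.
move=> mD intf intg fg; rewrite /Rintegral; congr fine.
apply: ae_eq_integral => //.
- exact: (measurable_int mu).
- exact: (measurable_int mu).
- apply: filterS fg; first exact: (ae_filter_ringOfSetsType mu).
  by move=> r + Dr => -> .
Qed.

End real_lemmas.

Lemma Rintegral_ae_addE {R : realType} (D : set R) (f g h : R -> R) :
  measurable D -> (@lebesgue_measure R).-integrable D (EFin \o f) ->
  (@lebesgue_measure R).-integrable D (EFin \o g) ->
  (@lebesgue_measure R).-integrable D (EFin \o h) ->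
  {ae @lebesgue_measure R, forall r, D r -> f r + g r = h r} ->
  \int[@lebesgue_measure R]_(r in D) f r + \int[@lebesgue_measure R]_(r in D) g r =
  \int[@lebesgue_measure R]_(r in D) h r.
Proof.
move=> mD intf intg inth fgh; rewrite -RintegralD//.
by apply: Rintegral_ae_eq => //; exact: integrable_add.
Qed.

Local Lemma balance_rearrange {R : realType} (a b c d e : R) :
  a + d = 0 -> d = b - c -> a = e -> e + b = c.
Proof. lra. Qed.

(** * The rate-independent dissipation *)

Section dissipation.
Context {R : realType} {Z V : hilbertType R} {X : completeNormedModType R}.
Variables (iZV : clin Z V) (iVX : clin V X) (D : Z -> R).
Hypothesis hD : dissipation_assumptions iZV iVX D.

Lemma dissipation0 : D 0 = 0.
Proof.
have [c [C [c0 C0 /(_ 0)]]] := dissipation_bounds hD.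
rewrite (linear0 iZV) normr0 mulr0 => /andP[_ h].
by apply/eqP; rewrite eq_le h (dissipation_ge0 hD).
Qed.

(** Convexity at the midpoint of 2 x and 2 y, and homogeneity. *)
Lemma dissipation_subadditive x y : D (x + y) <= D x + D y.
Proof.
have half0 : 0 <= 2^-1 :> R by [].
have half1 : 2^-1 <= 1 :> R by rewrite invf_le1// ler1n.
have := dissipation_convex hD (Itv01 half0 half1) (x := 2 *: x) (y := 2 *: y).
rewrite !inE => /(_ Logic.I Logic.I).
have -> : (conv (Itv01 half0 half1) (2 *: x : convex_lmodType Z) (2 *: y) : Z) = x + y.
  change (2^-1 *: (2 *: x) + (1 - 2^-1) *: (2 *: y) = x + y).
  rewrite !scalerA; have -> : (1 - 2^-1) * 2 = 1 :> R by field.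
  by rewrite mulVf// !scale1r.
rewrite !(dissipation_hom hD)// => h.
have : D (x + y) <= 2^-1 * (2 * D x) + (1 - 2^-1) * (2 * D y) by exact: h.
lra.
Qed.

(** A subadditive function bounded by a multiple of a norm is Lipschitz for
it. *)
Lemma dissipation_continuous : continuous D.
Proof.
have [c [C [c0 C0 HC]]] := dissipation_bounds hD.
have lip x y : D x - D y <= C * `|iZV (x - y)|.
  have /andP[_ h] := HC (x - y); apply: le_trans h.
  by rewrite lerBlDl -{1}(subrKC y x) dissipation_subadditive.
move=> x; apply/cvgrPdist_le => e e0.
have : (fun y => C * opnorm iZV * `|x - y|) @ x --> (0 : R).
  rewrite -[X in _ --> X](_ : C * opnorm iZV * `|x - x| = 0); last first.
    by rewrite subrr normr0 mulr0.
  apply: cvgM; first exact: cvg_cst.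
  by apply: cvg_norm; apply: cvgB; [exact: cvg_cst|exact: cvg_id].
move=> /cvgrPdist_le/(_ _ e0); apply: filterS => y.
rewrite sub0r normrN; apply: le_trans; apply: (le_trans _ (ler_norm _)).
apply: (@le_trans _ _ (C * `|iZV (x - y)|)).
  rewrite ler_norml lerNl opprB lip andbT (le_trans (lip y x))//.
  by rewrite -(opprB x y) (linearN iZV) normrN.
by rewrite -mulrA ler_pM2l// opnorm_ub.
Qed.

End dissipation.

(** * The subdifferential of the viscous dissipation *)

Section viscous_dissipation.
Context {R : realType} {Z V : hilbertType R} {X : completeNormedModType R}.
Variables (iZV : clin Z V) (iVX : clin V X).
Variables (A : clin Z (dual_space Z)) (D : Z -> R).
Variables (eps delta : R).
Hypothesis ellA : elliptic_operator A.
Hypothesis hD : dissipation_assumptions iZV iVX D.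
Hypothesis eps0 : 0 < eps.
Hypothesis delta0 : 0 < delta.

Local Notation M := (viscosity iZV A eps delta).

Lemma viscosity_sym v w : M v w = M w v.
Proof.
by rewrite !viscosityE !rieszE dotpC (elliptic_sym ellA).
Qed.

Lemma normA_sqr v : normA A v ^+ 2 = A v v.
Proof.
rewrite /normA sqr_sqrtr//.
have [alpha alpha0 HA] := elliptic_coercive ellA.
by apply: le_trans (HA v); rewrite mulr_ge0 ?sqr_ge0 ?ltW.
Qed.

Lemma viscosity_quadratic v :
  eps / 2 * `|iZV v| ^+ 2 + delta / 2 * normA A v ^+ 2 = 2^-1 * M v v.
Proof.
by rewrite viscosityE rieszE dotp_norm normA_sqr; ring.
Qed.

Lemma viscosity_le0 v : M v v <= 0 -> v = 0.
Proof.
rewrite viscosityE rieszE dotp_norm => h.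
have [alpha alpha0 HA] := elliptic_coercive ellA.
have h1 : 0 <= eps * `|iZV v| ^+ 2 by rewrite mulr_ge0 ?sqr_ge0 ?ltW.
have h2 : delta * (alpha * `|v| ^+ 2) <= 0.
  by have := HA v; rewrite -(ler_pM2l delta0); lra.
move: h2; rewrite pmulr_rle0// pmulr_rle0// => h2.
by apply/eqP; rewrite -normr_eq0 -sqrf_eq0 eq_le h2 sqr_ge0.
Qed.

(** Compare v with v + tau w and with (1 - tau / 2) v. Subadditivity,
respectively homogeneity, makes the contribution of D linear in tau, that of
the quadratic part is tau (M v w), respectively - tau / 2 (M v v), up to
O(tau^2); divide by tau and let tau tend to 0. *)
Lemma subdiff_viscous v (xi : dual_space Z) :
  subdiff (viscous_dissipation iZV A D eps delta) v xi ->
  (forall w, (xi - M v) w <= D w) /\ D v <= (xi - M v) v.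
Proof.
move=> Hxi.
have ME x y (c : R) : M (x + c *: y) (x + c *: y) =
    M x x + 2 * c * M x y + c ^+ 2 * M y y :> R.
  have sxy := viscosity_sym y x.
  by rewrite (bilinear_linE M) !dual_linE sxy; ring.
have vE x : viscous_dissipation iZV A D eps delta x = D x + 2^-1 * M x x.
  by rewrite /viscous_dissipation -addrA viscosity_quadratic.
have Hc (c : R) w : D v + c * xi w <=
    D (v + c *: w) + c * M v w + c ^+ 2 * (2^-1 * M w w).
  have := Hxi (v + c *: w).
  rewrite !vE ME (_ : v + c *: w - v = c *: w); last by rewrite addrAC subrr add0r.
  rewrite dual_scaleE; lra.
have subE w : (xi - M v) w = xi w - M v w by [].
split=> [w|].
  rewrite subE; apply: (@le_of_le_addM _ _ _ (2^-1 * M w w)) => tau tau0 _.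
  have := Hc tau w.
  have := dissipation_subadditive hD v (tau *: w).
  rewrite (dissipation_hom hD)// => h1 h2.
  rewrite -(ler_pM2l tau0); lra.
rewrite subE; apply: (@le_of_le_addM _ _ _ (4^-1 * M v v)) => tau tau0 tau1.
have := Hc (- (tau / 2)) v.
have -> : v + - (tau / 2) *: v = (1 - tau / 2) *: v.
  by rewrite scalerBl scale1r scaleNr.
rewrite (dissipation_hom hD); last lra.
have t2 : 0 < tau / 2 by lra.
move=> h; rewrite -(ler_pM2l t2); lra.
Qed.

End viscous_dissipation.

(** * The solution of the viscous system *)

Section solution.
Context {R : realType} {Z V : hilbertType R} {X : completeNormedModType R}.
Local Notation mu := (@lebesgue_measure R).
Variables (iZV : clin Z V) (iVX : clin V X).
Variables (A : clin Z (dual_space Z)) (F : Z -> R^o) (D : Z -> R).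
Variables (T eps delta : R) (z0 : Z) (l dl : R -> dual_space V).
Variables (z dz ddz : R -> Z).
Hypothesis T0 : 0 < T.
Hypothesis ellA : elliptic_operator A.
Hypothesis hD : dissipation_assumptions iZV iVX D.
Hypothesis F2 : class_C2 F.
Hypothesis eps0 : 0 < eps.
Hypothesis delta0 : 0 < delta.
Hypothesis hl : in_H1 T l dl.
Hypothesis hz : in_H1 T z dz.
Hypothesis hdz : in_H1 T dz ddz.
Hypothesis hini : subdiff D 0 (- D_energy iZV A F (l 0) z0).
Hypothesis hsol : solves_RIS iZV A F D eps delta T l z0 z dz.

Local Notation M := (viscosity iZV A eps delta).
Definition force (s : R) : dual_space Z := D_energy iZV A F (l s) (z s).
Definition force_rate (t : R) : dual_space Z :=
  D2_reduced_energy A F (z t) (dz t) - clin_adjoint iZV (dl t).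
(** What remains of the inclusion once the viscous force M z' is moved to the
other side: an element of the subdifferential of D at the velocity. *)
Definition friction (s : R) : dual_space Z := - force s - M (dz s).

Lemma forceE :
  force = (frechet (reduced_energy A F) \o z) - (clin_adjoint iZV \o l).
Proof.
by apply/funext => s; rewrite /force D_energyE// frechet_reduced_energy.
Qed.

Lemma force_is_derive (t : R) : is_derive t 1 z (dz t) -> is_derive t 1 l (dl t) ->
  is_derive t 1 force (force_rate t).
Proof.
move=> z' l'; rewrite forceE; apply: is_deriveB.
- apply: (is_derive_curve_comp (g := frechet (reduced_energy A F))) => //.
  by rewrite (frechet_reduced_energy ellA F2); exact: differentiable_Dreduced.
- exact: is_derive_curve_clin.
Qed.

Let cz : {within `[0, T], continuous z}.
Proof. exact: H1_continuous (ltW T0) (@norming_dual_hilbert R Z) hz. Qed.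
Let cdz : {within `[0, T], continuous dz}.
Proof. exact: H1_continuous (ltW T0) (@norming_dual_hilbert R Z) hdz. Qed.
Let cl : {within `[0, T], continuous l}.
Proof. exact: H1_continuous (ltW T0) (@norming_dual_dual R V) hl. Qed.

Lemma friction_continuous : {within `[0, T], continuous friction}.
Proof.
have cG : {within `[0, T], continuous force}.
  rewrite forceE; apply: within_continuousB.
    apply: within_continuous_post cz _ => x.
    rewrite (frechet_reduced_energy ellA F2); apply: differentiable_continuous.
    exact: differentiable_Dreduced.
  by apply: within_continuous_post cl _; exact: clin_continuous.
have -> : friction = (fun s => - (force s + M (dz s))).
  by apply/funext => s; rewrite /friction -opprD.
have cM : {within `[0, T], continuous (M \o dz)}.
  by apply: within_continuous_post cdz _; exact: clin_continuous.
apply: (within_continuous_post (g := -%R) _ opp_continuous).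
exact: within_continuousD cG cM.
Qed.

Lemma friction_ae : {ae mu, forall t : R, t \in `]0, T[ ->
  (forall w, friction t w <= D w) /\ D (dz t) <= friction t (dz t)}.
Proof.
case: hsol => _; apply: filterS; first exact: (ae_filter_ringOfSetsType mu).
move=> t Ht tI; have [xi Hxi xiG] := Ht tI.
have xiE : xi = - force t by apply/eqP; rewrite -addr_eq0; apply/eqP.
have := subdiff_viscous ellA hD Hxi.
by rewrite xiE.
Qed.

(** Both conditions are closed, and [friction] and [dz] are continuous, so
they pass from almost every time to all times. The time 0 is needed for the
initial velocity, and all s near t for the maximality argument. *)
Lemma friction_subdiff t : 0 <= t <= T ->
  (forall w, friction t w <= D w) /\ D (dz t) <= friction t (dz t).
Proof.
move=> tT; split=> [w|].
- rewrite -subr_le0.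
  apply: (@ae_le0_within _ T (fun t => friction t w - D w)) => //.
    apply: within_continuousB; last exact: cst_continuous.
    apply: within_continuous_eval; first exact: friction_continuous.
    exact: cst_continuous.
  apply: filterS friction_ae; first exact: (ae_filter_ringOfSetsType mu).
  by move=> s Hs /Hs[+ _]; rewrite subr_le0; apply.
- rewrite -subr_le0.
  apply: (@ae_le0_within _ T (fun t => D (dz t) - friction t (dz t))) => //.
    apply: within_continuousB.
      by apply: within_continuous_post cdz _; exact: dissipation_continuous hD.
    by apply: within_continuous_eval => //; exact: friction_continuous.
  apply: filterS friction_ae; first exact: (ae_filter_ringOfSetsType mu).
  by move=> s Hs /Hs[_]; rewrite subr_le0.
Qed.

(** The compatibility of the initial data bounds <- G(0), z'(0)> by D(z'(0)),
and the inclusion at time 0 bounds D(z'(0)) by <- G(0) - M z'(0), z'(0)>. *)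
Lemma dz0 : dz 0 = 0.
Proof.
apply: (viscosity_le0 ellA eps0 delta0 (iZV := iZV)).
have T00 : 0 <= (0 : R) <= T by rewrite lexx ltW.
have [_ h] := friction_subdiff T00.
have z0E : z 0 = z0 by case: hsol.
have fE : friction 0 (dz 0) = - force 0 (dz 0) - M (dz 0) (dz 0) by [].
have := hini (dz 0); rewrite subr0 (dissipation0 hD) add0r -z0E => h0.
have : - force 0 (dz 0) <= D (dz 0) by exact: h0.
by move: h; rewrite fE; lra.
Qed.

(** The function s |-> <friction s, z'(t)> is at most D(z'(t)), a value it
attains at s = t, so its derivative at t is zero. *)
Lemma derive_balance (t : R) : t \in `]0, T[ ->
  is_derive t 1 force (force_rate t) -> is_derive t 1 dz (ddz t) ->
  M (ddz t) (dz t) + force_rate t (dz t) = 0.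
Proof.
move=> tI force' dz'.
have Mdz' : is_derive t 1 (M \o dz) (M (ddz t)) by exact: is_derive_curve_clin.
have frE : friction = - force - (M \o dz) by [].
have friction' : is_derive t 1 friction (- force_rate t - M (ddz t)).
  by rewrite frE; apply: is_deriveB.
have := is_derive_curve_clin (eval_at (dz t)) friction'.
have -> : eval_at (dz t) \o friction = (fun s => friction s (dz t) : R^o).
  by apply/funext => s; exact: (eval_atE (dz t) (friction s)).
rewrite eval_atE => pairing'.
have /andP[t0 tT] : 0 < t < T by move: tI; rewrite in_itv.
have tT' : 0 <= t <= T by rewrite !ltW.
have [_ e2] := friction_subdiff tT'.
have E0 : (- force_rate t - M (ddz t)) (dz t) =
    - force_rate t (dz t) - M (ddz t) (dz t) by [].
rewrite E0 in pairing'.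
suff : - force_rate t (dz t) - M (ddz t) (dz t) = 0 by lra.
apply: (is_derive_local_max (g := fun s => friction s (dz t)) pairing').
near=> s.
have sT : 0 <= s <= T.
  by apply/andP; split; apply: ltW; near: s; [exact: lt_nbhsr|exact: lt_nbhsl].
have [h _] := friction_subdiff sT.
exact: le_trans (h (dz t)) e2.
Unshelve. all: by end_near. Qed.

Lemma ae_balance : {ae mu, forall t : R, t \in `]0, T[ ->
  is_derive t 1 (force) (force_rate t) /\
  M (ddz t) (dz t) + force_rate t (dz t) = 0}.
Proof.
have z' := H1_ae_is_derive (@norming_dual_hilbert R Z) hz.
have dz' := H1_ae_is_derive (@norming_dual_hilbert R Z) hdz.
have l' := H1_ae_is_derive (@norming_dual_dual R V) hl.
apply: filterS3 z' dz' l'; first exact: (ae_filter_ringOfSetsType mu).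
move=> t z' dz' l' tI.
have force' := force_is_derive (z' tI) (l' tI).
split => //.
exact: (derive_balance tI force' (dz' tI)).
Qed.

Lemma integrable_D2 :
  mu.-integrable `]0, T[
    (EFin \o (fun r => D2_reduced_energy A F (z r) (dz r) (dz r))).
Proof.
have cD2 : continuous (D2_reduced_energy A F).
  have -> : D2_reduced_energy A F = cst A + frechet (frechet F).
    by apply/funext => y; rewrite D2_reduced_energyE.
  move=> y; apply: cvgD; first exact: cvg_cst.
  by case: F2 => _ [_]; exact.
have c1 : {within `[0, T], continuous (fun r => D2_reduced_energy A F (z r))}.
  exact: within_continuous_post cz cD2.
have c2 := within_continuous_eval c1 cdz.
have c3 := within_continuous_eval c2 cdz.
have : mu.-integrable `[0, T] (EFin \o
    (fun r => D2_reduced_energy A F (z r) (dz r) (dz r))).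
  by apply: continuous_compact_integrable => //; exact: segment_compact.
by apply: integrableS => //; exact: subset_itv_oo_cc.
Qed.

Lemma integrable_power :
  mu.-integrable `]0, T[ (EFin \o (fun r => dl r (iZV (dz r)))).
Proof.
have [C dzC] := H1_bounded (ltW T0) (@norming_dual_hilbert R Z) hdz.
apply: (H1_integrable_pairing hl (q := fun r f => f (iZV (dz r)))
  (M := opnorm iZV * C)).
- move=> f; apply: continuous_within_measurable.
  have -> : (fun r => f (iZV (dz r)) : R) = (f \o iZV) \o dz by [].
  apply: within_continuous_post cdz _ => y.
  by apply: continuous_comp; exact: clin_continuous.
- move=> r.
  have -> : (fun f : dual_space V => f (iZV (dz r)) : R) = eval_at (iZV (dz r)).
    by apply/funext => f; rewrite eval_atE.
  exact: clin_continuous.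
- move=> r f rT; apply: (le_trans (opnorm_ub f _)); rewrite mulrC.
  apply: ler_wpM2r; first exact: opnorm_ge0.
  by apply: (le_trans (opnorm_ub iZV _)); rewrite ler_wpM2l ?opnorm_ge0// dzC.
Qed.

(** The first term is the integral of <M z', z''>, because z'(0) = 0, and the
integrands cancel almost everywhere by [ae_balance]. *)
Lemma energy_balance t : 0 <= t <= T ->
  2^-1 * M (dz t) (dz t)
    + \int[mu]_(r in `]0, t[) (D2_reduced_energy A F (z r) (dz r) (dz r))
  = \int[mu]_(r in `]0, t[) (dl r (iZV (dz r))).
Proof.
move=> tT; have /andP[t0 tT'] := tT.
have quad := H1_quadratic (ltW T0) (@norming_dual_hilbert R Z) hdz
  (viscosity_sym iZV eps delta ellA) tT.
have M00 : M (dz 0) (dz 0) = 0 by rewrite dz0; exact: (linear0 (M 0)).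
rewrite M00 mulr0 subr0 in quad; rewrite quad.
have intM : mu.-integrable `]0, t[ (EFin \o (fun r => M (dz r) (ddz r))).
  apply: integrable_oo (H1_integrable_bilinear (ltW T0) _ hdz M) => //.
  exact: norming_dual_hilbert.
have intD2 := integrable_oo (lexx 0) tT' integrable_D2.
have intP := integrable_oo (lexx 0) tT' integrable_power.
apply: (Rintegral_ae_addE (f := fun r => M (dz r) (ddz r))
  (g := fun r => D2_reduced_energy A F (z r) (dz r) (dz r))
  (h := fun r => dl r (iZV (dz r)))) => //.
apply: filterS ae_balance; first exact: (ae_filter_ringOfSetsType mu).
move=> r Hr rI.
have /andP[r0 rt] : 0 < r < t by move: rI; rewrite /= in_itv.
have rT : r \in `]0, T[ by rewrite in_itv/= r0 (lt_le_trans rt).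
have [_ bal] := Hr rT.
have rate : force_rate r (dz r) =
    D2_reduced_energy A F (z r) (dz r) (dz r) - dl r (iZV (dz r)).
  by rewrite /force_rate add_clinE opp_clinE clin_adjointE.
have sym := viscosity_sym iZV eps delta ellA (ddz r) (dz r).
exact: (balance_rearrange bal rate sym).
Qed.

End solution.

Unset Implicit Arguments.

Theorem lemma4p4 (R : realType) (Z V : hilbertType R)
    (X W : completeNormedModType R)
    (iZV : clin Z V) (iVX : clin V X) (iZW : clin Z W) (iWV : clin W V)
    (A : clin Z (dual_space Z)) (F : Z -> R^o) (D : Z -> R)
    (T eps delta : R) (z0 : Z) (l dl : R -> dual_space V)
    (z dz ddz : R -> Z) :
  0 < T ->
  space_assumptions iZV iVX iZW iWV ->
  elliptic_operator A ->
  potential_assumptions iZV iZW F ->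
  dissipation_assumptions iZV iVX D ->
  0 < eps -> 0 < delta ->
  in_H1 T l dl ->
  subdiff D 0 (- D_energy iZV A F (l 0) z0) ->
  in_H2 T z dz ddz ->
  solves_RIS iZV A F D eps delta T l z0 z dz ->
  {ae lebesgue_measure, forall t : R, t \in `]0, T[ ->
    derivable (fun s => D_energy iZV A F (l s) (z s)) t 1 /\
    eps * riesz (iZV (ddz t)) (iZV (dz t)) + delta * A (ddz t) (dz t)
      + derive1 (fun s => D_energy iZV A F (l s) (z s)) t (dz t) = 0} /\
  (forall t : R, t \in `[0, T] ->
    eps / 2 * `|iZV (dz t)| ^+ 2 + delta / 2 * normA A (dz t) ^+ 2
      + \int[lebesgue_measure]_(r in `[0, t])
          (D2_reduced_energy A F (z r) (dz r) (dz r))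
    = \int[lebesgue_measure]_(r in `[0, t]) (dl r (iZV (dz r)))).
Proof.
move=> T0 _ ellA hF hD eps0 delta0 hl hini [hz hdz] hsol.
have F2 := potential_C2 hF.
split.
  apply: filterS (ae_balance T0 ellA hD F2 hl hz hdz hsol).
    exact: (ae_filter_ringOfSetsType lebesgue_measure).
  move=> t Ht tI; have [force' bal] := Ht tI.
  split; first by case: force'.
  rewrite derive1E (derive_val (is_derive := force')) -viscosityE.
  exact: bal.
move=> t; rewrite in_itv/= => tT; have /andP[t0 tT'] := tT.
rewrite (viscosity_quadratic _ _ _ ellA).
(* the derivatives are only controlled on the open interval; the two end points
   form a null set *)
have closed_open (f : R -> R) : lebesgue_measure.-integrable `]0, T[ (EFin \o f) ->
    \int[lebesgue_measure]_(r in `[0, t]) f r =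
    \int[lebesgue_measure]_(r in `]0, t[) f r.
  move=> intf; have intft := integrable_oo (lexx 0) tT' intf.
  have mf := measurable_int _ intft.
  rewrite /Rintegral -integral_itv_obnd_cbnd; last first.
    exact/measurable_realfun.emeasurable_fun_itv_bndo_bndcP.
  by rewrite -integral_itv_bndo_bndc.
rewrite !closed_open; first exact:
  (energy_balance T0 ellA hD F2 eps0 delta0 hl hz hdz hini hsol tT).
- exact: (integrable_power iZV T0 hl hdz).
- exact: (integrable_D2 T0 ellA F2 hz hdz).
Qed.
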